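(* Let $\Bbbk$ be a field and let $(\mathcal{C}',X)$ be a strict graded minimal categorification over $\Bbbk$. If its three-strand structure is $\nu$-standard for some $\nu\in\Bbbk^\times$, then there is a strict graded monoidal isomorphism $\mathcal{C}'\cong\mathcal{NC}'_\nu$ preserving the chosen generator.
   Context: **Graded minimal categorifications.** Put $[k]=(q^k-q^{-k})/(q-q^{-1})$, $[n]!=[n]\cdots[1]$. A graded minimal categorification (of the quantum divided powers ring) is a $\Bbbk$-linear $\mathbb Z$-graded additive monoidal category $\mathcal{C}'$ with a generating object $X$ such that every object is a finite direct sum of grading shifts of the objects $X^{\otimes n}$, there are no nonzero homs (of any degree) between $X^{\otimes n}$ and $X^{\otimes m}$ for $n\ne m$, and the full graded endomorphism algebra $A_n$ of $X^{\otimes n}$ is isomorphic, as a graded algebra, to $\operatorname{End}_\Bbbk(W_n)$ for a graded vector space $W_n$ of graded dimension $[n]!$. Equivalently, it is a system of such graded algebras $A_n$ ($n\ge0$, $A_0=\Bbbk$) with unital graded algebra homomorphisms $\psi_{n,m}:A_n\otimes A_m\to A_{n+m}$ (given by tensor product of morphisms) satisfying $\psi_{n+m,r}(\psi_{n,m}\otimes\mathrm{id})=\psi_{n,m+r}(\mathrm{id}\otimes\psi_{m,r})$ and $\psi_{0,n}=\psi_{n,0}=\mathrm{id}$. In terms of systems, a strict graded monoidal isomorphism preserving the generator is a family of graded algebra isomorphisms $\Phi_n:A_n\to A_n'$ commuting with all $\psi_{n,m}$. **The category $\mathcal{NC}'_\nu$.** Let $\widehat{\mathsf{NC}}_n$ be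 the subalgebra of $\operatorname{End}_\Bbbk(\Bbbk[x_1,\dots,x_n])$ generated by the operators $\partial_i(f)=(f-s_if)/(x_i-x_{i+1})$ (degree $-2$; $s_i$ swaps $x_i,x_{i+1}$) and $\partial_i^-=-x_i\partial_ix_{i+1}$, i.e. $f\mapsto -x_i\partial_i(x_{i+1}f)$ (degree $2$), $1\le i\le n-1$. Let $\psi^1_{n,m}:\widehat{\mathsf{NC}}_n\otimes\widehat{\mathsf{NC}}_m\to\widehat{\mathsf{NC}}_{n+m}$ be the inclusion $\partial_i^{\pm}\otimes1\mapsto\partial_i^{\pm}$, $1\otimes\partial_j^{\pm}\mapsto\partial_{n+j}^{\pm}$. For $\nu\in\Bbbk^\times$, $\mathcal{NC}'_\nu$ is the strict graded minimal categorification with $A_n=\widehat{\mathsf{NC}}_n$ and tensor product maps, on homogeneous elements, $\psi^\nu_{n,m}(a\otimes b)=\nu^{-n\deg(b)/2}\,\psi^1_{n,m}(a\otimes b)$. **$\nu$-standard three-strand structures.** In a graded minimal categorification choose homogeneous $\partial\in A_2$ of degree $-2$ and $\partial^-\in A_2$ of degree $2$ with $\partial^2=(\partial^-)^2=0$, $\partial\partial^-+\partial^-\partial=1$ (such a pair is unique up to $(\partial,\partial^-)\mapsto(t\partial,t^{-1}\partial^-)$, $t\in\Bbbk^\times$). The distinguished local generators of $A_3$ are $\partial_1=\psi_{2,1}(\partial\otimes1)$, $\partial_2=\psi_{1,2}(1\otimes\partial)$, $\partial_1^-=\psi_{2,1}(\partial^-\otimes1)$, $\partial_2^-=\psi_{1,2}(1\otimes\partial^-)$.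 The three-strand structure is $\nu$-standard if there is a graded algebra isomorphism from $A_3$ to the corresponding algebra $\widehat{\mathsf{NC}}_3$ of $\mathcal{NC}'_\nu$ carrying the four distinguished local generators $\partial_1,\partial_2,\partial_1^-,\partial_2^-$ of $A_3$ to those of $\mathcal{NC}'_\nu$, namely to the operators $\partial_1,\ \nu\partial_2,\ \partial_1^-,\ \nu^{-1}\partial_2^-$ in $\widehat{\mathsf{NC}}_3$, respectively. *)

(* Defs.v *)
(* boolp and functions provide classical subtypes and the module of all
   functions, inside which the linear endomorphisms are cut out. *)
From HB Require Import structures.
From mathcomp Require Import all_boot all_order all_fingroup all_algebra.
From mathcomp Require Import boolp functions.
From mathcomp Require Import ssrcomplements mpoly.

Set Implicit Arguments.
Unset Strict Implicit.
Unset Printing Implicit Defensive.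

Import GRing.Theory Num.Theory.

Local Open Scope ring_scope.

(* Z[q, q^-1] sits inside the field Z(q). *)
Definition qvar : {fraction {poly int}} := tofrac ('X : {poly int}).

Definition qint (n : nat) : {fraction {poly int}} :=
  (qvar ^+ n - qvar ^- n) / (qvar - qvar^-1).

Definition qfact (n : nat) : {fraction {poly int}} :=
  \prod_(1 <= i < n.+1) qint i.

(* [gsupp] is any finite set of degrees containing all the nonzero ones. *)
Record gradedVect (k : fieldType) := GradedVect {
  gsort :> vectType k;
  gpart : int -> {vspace gsort};
  gsupp : seq int;
  gsupp_uniq : uniq gsupp;
  gsupp_out : forall d, d \notin gsupp -> gpart d = 0%VS;
  gpart_direct : directv (\sum_(d <- gsupp) gpart d);
  gpart_full : (\sum_(d <- gsupp) gpart d)%VS = fullv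
}.

Definition gdim (k : fieldType) (W : gradedVect k) : {fraction {poly int}} :=
  \sum_(d <- gsupp W) (\dim (gpart W d))%:R * qvar ^ d.

Definition End_homog (k : fieldType) (W : gradedVect k) (d : int)
    (f : 'End(W)) : Prop :=
  forall e : int, (f @: gpart W e <= gpart W (e + d))%VS.

(* [alg n] is the graded endomorphism algebra of the n-th tensor power of the
   generator, [has_deg d] its set of homogeneous elements of degree d, and
   [tens n m] the bilinear map underlying the tensor product homomorphism. *)
Record tensorSystem (k : fieldType) := TensorSystem {
  alg : nat -> algType k;
  has_deg : forall n, int -> alg n -> Prop;
  tens : forall n m, alg n -> alg m -> alg (n + m)
}.

Arguments has_deg {k} t {n}.
Arguments tens {k} t {n m}.

Definition graded_iso_End (k : fieldType) (C : tensorSystem k) (n : nat)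
    (W : gradedVect k) : Prop :=
  exists phi : {linear alg C n -> 'End(W)},
    [/\ bijective phi,
        phi 1 = \1%VF,
        forall a b, phi (a * b) = (phi a \o phi b)%VF
      & forall d a, has_deg C d a <-> End_homog d (phi a)].

(* A unital graded algebra homomorphism out of the tensor product of two
   algebras is a bilinear map with the last three properties. *)
Definition graded_tensor_hom (k : fieldType) (C : tensorSystem k)
    (n m : nat) : Prop :=
  [/\ (forall a : alg C n, linear (fun b : alg C m => tens C a b)) /\
      (forall b : alg C m, linear (fun a : alg C n => tens C a b)),
      tens C (1 : alg C n) (1 : alg C m) = 1,
      forall (a a' : alg C n) (b b' : alg C m),
        tens C (a * a') (b * b') = tens C a b * tens C a' b'
    & forall d e (a : alg C n) (b : alg C m),
        has_deg C d a -> has_deg C e b -> has_deg C (d + e) (tens C a b)].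

Definition graded_minimal_categorification (k : fieldType)
    (C : tensorSystem k) : Prop :=
  [/\ forall n, exists2 W : gradedVect k,
        gdim W = qfact n & graded_iso_End C n W,
      bijective (fun c : k => c%:A : alg C 0),
      forall n m, graded_tensor_hom C n m,
      forall n m r (a : alg C n) (b : alg C m) (c : alg C r),
        tens C (tens C a b) c =
        ecast i (alg C i) (addnA n m r) (tens C a (tens C b c))
    & forall n (c : k) (a : alg C n),
        tens C (c%:A : alg C 0) a = c *: a /\
        ecast i (alg C i) (addn0 n) (tens C a (c%:A : alg C 0)) = c *: a].

Definition tensorSystem_iso (k : fieldType) (C D : tensorSystem k) : Prop :=
  exists Phi : forall n, {lrmorphism alg C n -> alg D n},
    [/\ forall n, bijective (Phi n),
        forall n d (a : alg C n), has_deg C d a <-> has_deg D d (Phi n a)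
      & forall n m (a : alg C n) (b : alg C m),
          Phi (n + m)%N (tens C a b) = tens D (Phi n a) (Phi m b)].

Section PolyEnd.
Variables (k : fieldType) (n : nat).
Local Notation P := {mpoly k[n]}.

Definition lin_pred : {pred (P -> P)} := fun f => `[<linear f>].

Lemma lin_predP (f : P -> P) : reflect (linear f) (f \in lin_pred).
Proof. exact: asboolP. Qed.

Lemma lin_pred_closed : GRing.submod_closed lin_pred.
Proof.
split=> [|a f g /lin_predP lf /lin_predP lg]; apply/lin_predP => c p q.
  by rewrite /= scaler0 addr0.
rewrite !fctE /= lf lg !scalerDr !scalerA mulrC -!addrA.
by congr (_ + _); rewrite addrCA.
Qed.

HB.instance Definition _ :=
  GRing.isSubmodClosed.Build k (P -> P) lin_pred lin_pred_closed.

Record polyEnd := PolyEnd { polyEnd_fun :> P -> P;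
                            polyEnd_lin : polyEnd_fun \in lin_pred }.

HB.instance Definition _ := [isSub for polyEnd_fun].
HB.instance Definition _ := [Choice of polyEnd by <:].
HB.instance Definition _ := [SubChoice_isSubLmodule of polyEnd by <:].

HB.instance Definition _ (a : polyEnd) :=
  GRing.isLinear.Build k P P _ (polyEnd_fun a)
    (elimT (lin_predP a) (polyEnd_lin a)).

Definition mkEnd (f : P -> P) (lf : linear f) : polyEnd :=
  PolyEnd (introT (lin_predP f) lf).

Lemma polyEndP (a b : polyEnd) : a =1 b <-> a = b.
Proof. by split=> [/funext /val_inj | ->]. Qed.

Lemma id_linear : linear (id : P -> P). Proof. by []. Qed.

Lemma comp_linear (a b : polyEnd) : linear (a \o b).
Proof. by move=> c p q /=; rewrite !linearP. Qed.

Definition oneEnd := mkEnd id_linear.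
Definition mulEnd (a b : polyEnd) := mkEnd (comp_linear a b).

Fact mulEndA : associative mulEnd. Proof. by move=> a b c; apply/polyEndP. Qed.
Fact mul1End : left_id oneEnd mulEnd. Proof. by move=> a; apply/polyEndP. Qed.
Fact mulEnd1 : right_id oneEnd mulEnd. Proof. by move=> a; apply/polyEndP. Qed.
Fact mulEndDl : left_distributive mulEnd +%R.
Proof. by move=> a b c; apply/polyEndP. Qed.
Fact mulEndDr : right_distributive mulEnd +%R.
Proof. by move=> a b c; apply/polyEndP=> p; rewrite /= linearD. Qed.
Fact oneEnd_neq0 : oneEnd != 0.
Proof.
apply/eqP => /polyEndP /(_ 1) /= /eqP; rewrite [X in _ == X](_ : _ = 0) //.
by rewrite oner_eq0.
Qed.

HB.instance Definition _ := GRing.Zmodule_isNzRing.Build polyEnd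
  mulEndA mul1End mulEnd1 mulEndDl mulEndDr oneEnd_neq0.

Fact scaleEndAl (c : k) (a b : polyEnd) : c *: (a * b) = (c *: a) * b.
Proof. by apply/polyEndP. Qed.
Fact scaleEndAr (c : k) (a b : polyEnd) : c *: (a * b) = a * (c *: b).
Proof. by apply/polyEndP=> p; rewrite /= [in RHS]linearZ. Qed.

HB.instance Definition _ := GRing.Lmodule_isLalgebra.Build k polyEnd scaleEndAl.
HB.instance Definition _ := GRing.Lalgebra_isAlgebra.Build k polyEnd scaleEndAr.

Lemma addEndE (a b : polyEnd) p : (a + b) p = a p + b p. Proof. by []. Qed.
Lemma oppEndE (a : polyEnd) p : (- a) p = - a p. Proof. by []. Qed.
Lemma scaleEndE c (a : polyEnd) p : (c *: a) p = c *: a p. Proof. by []. Qed.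
Lemma mulEndE (a b : polyEnd) p : (a * b) p = a (b p). Proof. by []. Qed.
Lemma oneEndE p : (1 : polyEnd) p = p. Proof. by []. Qed.

(* The same facts as [linearP] and its variants, stated on [polyEnd_fun]. *)
Lemma EndP (a : polyEnd) c p q : a (c *: p + q) = c *: a p + a q.
Proof. exact: (linearP a). Qed.
Lemma EndD (a : polyEnd) p q : a (p + q) = a p + a q.
Proof. exact: (linearD a). Qed.
Lemma End0 (a : polyEnd) : a 0 = 0.
Proof. exact: (linear0 a). Qed.
Lemma EndZ (a : polyEnd) c p : a (c *: p) = c *: a p.
Proof. by rewrite -[c *: p]addr0 EndP End0 addr0. Qed.

End PolyEnd.

(* Each variable has degree 2, so an operator of degree d sends polynomials of
   total degree e to polynomials of total degree e + d / 2. *)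
Definition op_degree (k : fieldType) (n : nat) (d : int) (a : polyEnd k n)
    : Prop :=
  forall (e : nat) (p : {mpoly k[n]}), p \is e.-homog ->
    forall m, m \in msupp (a p) -> (mdeg m)%:Z *+ 2 = e%:Z *+ 2 + d.

Section Demazure.
Variables (k : fieldType) (n i : nat) (lt_i : (i.+1 < n)%N).
Local Notation P := {mpoly k[n]}.

Definition lo : 'I_n := Ordinal (ltnW lt_i).
Definition hi : 'I_n := Ordinal lt_i.

Definition swap (p : P) : P := msym (tperm lo hi) p.

Lemma swap_linear : linear swap.
Proof. by move=> c p q; rewrite /swap linearP. Qed.

Lemma swapM p q : swap (p * q) = swap p * swap q.
Proof. exact: msymM. Qed.

Lemma swapX j : swap 'X_j = 'X_(tperm lo hi j).
Proof.
rewrite /swap msymX; congr 'X_[_]; apply/mnmP => l.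
rewrite mnmE !mnm1E tpermV; congr (nat_of_bool _).
by rewrite -[in RHS](tpermK lo hi l) (inj_eq perm_inj).
Qed.

Lemma swap1 : swap 1 = 1. Proof. exact: msym1. Qed.

Lemma lo_neq_hi : lo != hi.
Proof. by apply/eqP => /(congr1 val) /= /eqP; rewrite ltn_eqF. Qed.

Lemma subX_neq0 : 'X_lo - 'X_hi != 0 :> P.
Proof.
apply/eqP => /(congr1 (mcoeff U_(lo)%MM)); rewrite mcoeff0 mcoeffB !mcoeffX.
rewrite eqxx; case: eqP => [/mnmP /(_ lo)|_].
  by rewrite !mnm1E eqxx eq_sym (negPf lo_neq_hi).
by move/eqP; rewrite subr0 oner_eq0.
Qed.

Lemma divdiff_ex (p : P) : exists g, ('X_lo - 'X_hi) * g = p - swap p.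
Proof.
have step (f g : P) : (exists h, ('X_lo - 'X_hi) * h = f - swap f) ->
    (exists h, ('X_lo - 'X_hi) * h = g - swap g) ->
    exists h, ('X_lo - 'X_hi) * h = f * g - swap (f * g).
  move=> [u hu] [v hv]; exists (u * g + swap f * v).
  by rewrite mulrDr mulrA hu mulrCA hv swapM mulrBl mulrBr addrA subrK.
have base j : exists h, ('X_lo - 'X_hi) * h = 'X_j - swap 'X_j :> P.
  rewrite swapX; case: tpermP => [->|->|_ _]; first by exists 1; rewrite mulr1.
    by exists (-1); rewrite mulrN1 opprB.
  by exists 0; rewrite mulr0 subrr.
have one : exists h, ('X_lo - 'X_hi) * h = 1 - swap 1 :> P.
  by exists 0; rewrite swap1 subrr mulr0.
elim/mpolyind: p => [|c m p _ _ [g hg]].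
  by exists 0; rewrite mulr0 /swap linear0 subrr.
have [h hh] : exists h, ('X_lo - 'X_hi) * h = 'X_[m] - swap 'X_[m] :> P.
  rewrite [in 'X_[m]]mpolyXE_id.
  apply: (big_ind (fun f => exists h, ('X_lo - 'X_hi) * h = f - swap f)) => // j _.
  by elim: (m j) => [|e IH]; rewrite ?expr0 // exprS; apply: step.
exists (c *: h + g); rewrite swap_linear mulrDr -scalerAr hh hg scalerBr.
by rewrite opprD addrACA.
Qed.

(* The quotient (p - s_i p) / (x_i - x_{i+1}), unique by [subX_neq0]. *)
Definition divdiff_fun (p : P) : P := sval (cid (divdiff_ex p)).

Lemma divdiffE p : ('X_lo - 'X_hi) * divdiff_fun p = p - swap p.
Proof. exact: svalP (cid (divdiff_ex p)). Qed.

Lemma divdiff_uniq p g : ('X_lo - 'X_hi) * g = p - swap p -> g = divdiff_fun p.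
Proof. by rewrite -divdiffE => /(mulfI subX_neq0). Qed.

Lemma divdiff_linear : linear divdiff_fun.
Proof.
move=> c p q; apply/esym/divdiff_uniq.
by rewrite mulrDr -scalerAr !divdiffE swap_linear scalerBr opprD addrACA.
Qed.

(* With x_1, ..., x_n numbered from 0, [divdiff] at [i] is the operator of
   index i + 1. *)
Definition divdiff : polyEnd k n := mkEnd divdiff_linear.

Lemma divdiff_minus_linear :
  linear (fun p : P => - ('X_lo * divdiff ('X_hi * p))).
Proof.
by move=> c p q; rewrite mulrDr -scalerAr linearP mulrDr -scalerAr opprD scalerN.
Qed.

Lemma divdiffM p q :
  divdiff (p * q) = divdiff p * q + swap p * divdiff q.
Proof.
apply/esym/divdiff_uniq; rewrite mulrDr mulrA mulrCA !divdiffE swapM.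
by rewrite mulrBl mulrBr addrA subrK.
Qed.

Definition divdiff_minus : polyEnd k n := mkEnd divdiff_minus_linear.

Lemma divdiff_minusE p :
  divdiff_minus p = - ('X_lo * divdiff ('X_hi * p)).
Proof. by []. Qed.

End Demazure.

Inductive inNC (k : fieldType) (n : nat) : polyEnd k n -> Prop :=
| inNC_divdiff i (lt_i : (i.+1 < n)%N) : inNC (divdiff k lt_i)
| inNC_divdiff_minus i (lt_i : (i.+1 < n)%N) : inNC (divdiff_minus k lt_i)
| inNC_1 : inNC 1
| inNC_lin c a b of inNC a & inNC b : inNC (c *: a + b)
| inNC_mul a b of inNC a & inNC b : inNC (a * b).

Section NC.
Variables (k : fieldType) (n : nat).

Definition NC_pred : {pred polyEnd k n} := fun a => `[<inNC a>].

Lemma NC_predP a : reflect (inNC a) (a \in NC_pred).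
Proof. exact: asboolP. Qed.

Lemma NC_pred_closed : GRing.subalg_closed NC_pred.
Proof.
split=> [|c a b|a b]; first by apply/NC_predP; apply: inNC_1.
  by move=> /NC_predP ? /NC_predP ?; apply/NC_predP/inNC_lin.
by move=> /NC_predP ? /NC_predP ?; apply/NC_predP/inNC_mul.
Qed.

HB.instance Definition _ :=
  GRing.isSubalgClosed.Build k (polyEnd k n) NC_pred NC_pred_closed.

Record NC := MkNC { NC_val :> polyEnd k n; NC_valP : NC_val \in NC_pred }.

HB.instance Definition _ := [isSub for NC_val].
HB.instance Definition _ := [Choice of NC by <:].
HB.instance Definition _ := [SubChoice_isSubAlgebra of NC by <:].

Definition mkNC (a : polyEnd k n) (aNC : inNC a) : NC :=
  MkNC (introT (NC_predP a) aNC).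

Definition NCd i (lt_i : (i.+1 < n)%N) : NC := mkNC (inNC_divdiff k lt_i).
Definition NCdm i (lt_i : (i.+1 < n)%N) : NC :=
  mkNC (inNC_divdiff_minus k lt_i).

End NC.

Lemma inNC0 (k : fieldType) n : inNC (0 : polyEnd k n).
Proof. by rewrite -(addNr 1) -scaleN1r; apply: inNC_lin; apply: inNC_1. Qed.

Lemma inNC_scale (k : fieldType) n c (a : polyEnd k n) :
  inNC a -> inNC (c *: a).
Proof. by move=> aNC; rewrite -[_ *: _]addr0; apply: inNC_lin (inNC0 _ _). Qed.

Section Outer.
Variables (k : fieldType) (n m : nat).

Definition lpoly (p : {mpoly k[n]}) : {mpoly k[n + m]} :=
  p \mPo [tuple 'X_(lshift m i) | i < n].
Definition rpoly (p : {mpoly k[m]}) : {mpoly k[n + m]} :=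
  p \mPo [tuple 'X_(rshift n i) | i < m].

Definition lmnm (u : 'X_{1..n + m}) : 'X_{1..n} :=
  [multinom u (lshift m i) | i < n].
Definition rmnm (u : 'X_{1..n + m}) : 'X_{1..m} :=
  [multinom u (rshift n i) | i < m].

Lemma mpolyX_split u : 'X_[u] = lpoly 'X_[lmnm u] * rpoly 'X_[rmnm u].
Proof.
rewrite /lpoly /rpoly !comp_mpolyX mpolyXE_id big_split_ord /=.
by congr (_ * _); apply: eq_bigr => i _; rewrite mnmE tnth_mktuple.
Qed.

Section OuterFun.
Variables (a : polyEnd k n) (b : polyEnd k m).

(* Linear extension of x^u y^v |-> a(x^u) b(y^v), the operator on
   k[x_1, ..., x_{n+m}] = k[x_1, ..., x_n] (x) k[x_{n+1}, ..., x_{n+m}]. *)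
Definition outer_fun (p : {mpoly k[n + m]}) : {mpoly k[n + m]} :=
  \sum_(u <- msupp p)
    p@_u *: (lpoly (a 'X_[lmnm u]) * rpoly (b 'X_[rmnm u])).

Lemma outer_funE N p : (msize p <= N)%N ->
  outer_fun p = \sum_(u : bmultinom (n + m) N)
    p@_u *: (lpoly (a 'X_[lmnm u]) * rpoly (b 'X_[rmnm u])).
Proof.
move=> le_pN; rewrite /outer_fun.
pose I : subFinType _ := bmultinom (n + m) N.
rewrite (big_mksub I) ?msupp_uniq //=; first last.
  by move=> x /msize_mdeg_lt /leq_trans; apply.
rewrite big_rmcond //= => u; move/memN_msupp_eq0 ->.
by rewrite scale0r.
Qed.

Lemma outer_linear : linear outer_fun.
Proof.
move=> c p q; pose N := maxn (msize p) (maxn (msize q) (msize (c *: p + q))).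
rewrite !(@outer_funE N) ?leq_max ?leqnn ?orbT //.
rewrite scaler_sumr -big_split /=; apply: eq_bigr => u _.
by rewrite mcoeffD mcoeffZ scalerDl scalerA.
Qed.

Definition outer : polyEnd k (n + m) := mkEnd outer_linear.

Lemma outerX u : outer 'X_[u] = lpoly (a 'X_[lmnm u]) * rpoly (b 'X_[rmnm u]).
Proof. by rewrite /= /outer_fun msuppX big_seq1 mcoeffX eqxx scale1r. Qed.

End OuterFun.

Lemma lmnm_split (u : 'X_{1..n}) (v : 'X_{1..m}) :
  exists2 w, lmnm w = u & rmnm w = v.
Proof.
exists [multinom match fintype.split i with inl j => u j | inr j => v j end | i < n + m].
  by apply/mnmP => i; rewrite !mnmE (unsplitK (inl i)).
by apply/mnmP => i; rewrite !mnmE (unsplitK (inr i)).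
Qed.

Lemma polyEnd_eqX N (a b : polyEnd k N) :
  (forall u, a 'X_[u] = b 'X_[u]) -> a = b.
Proof.
move=> eq_ab; apply/polyEndP; elim/mpolyind => [|c u p _ _ IH].
  by rewrite !End0.
by rewrite !EndP IH eq_ab.
Qed.

Lemma lpolyP c p q : lpoly (c *: p + q) = c *: lpoly p + lpoly q.
Proof. exact: linearP. Qed.
Lemma rpolyP c p q : rpoly (c *: p + q) = c *: rpoly p + rpoly q.
Proof. exact: linearP. Qed.
Lemma lpoly0 : lpoly 0 = 0. Proof. exact: linear0. Qed.
Lemma rpoly0 : rpoly 0 = 0. Proof. exact: linear0. Qed.

(* The characteristic property: a acts on the first n variables and b on the
   last m ones. *)
Lemma outerE a b f g :
  outer a b (lpoly f * rpoly g) = lpoly (a f) * rpoly (b g).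
Proof.
elim/mpolyind: f => [|c u f _ _ IHf].
  by rewrite End0 !lpoly0 !mul0r End0.
rewrite EndP !lpolyP !mulrDl -!scalerAl EndP {}IHf; congr (_ *: _ + _).
elim/mpolyind: g => [|d v g _ _ IHg].
  by rewrite End0 !rpoly0 !mulr0 End0.
rewrite EndP !rpolyP !mulrDr -!scalerAr EndP {}IHg; congr (_ *: _ + _).
by have [w <- <-] := lmnm_split u v; rewrite -mpolyX_split; apply: outerX.
Qed.

Lemma outer_eq (a : polyEnd k n) (b : polyEnd k m) (c : polyEnd k (n + m)) :
  (forall f g, c (lpoly f * rpoly g) = lpoly (a f) * rpoly (b g)) ->
  c = outer a b.
Proof.
move=> cE; apply: polyEnd_eqX => u.
by rewrite mpolyX_split cE outerE.
Qed.

Lemma outer1 : outer 1 1 = 1.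
Proof. by apply/esym/outer_eq. Qed.

Lemma outerM a a' b b' : outer (a * a') (b * b') = outer a b * outer a' b'.
Proof. by apply/esym/outer_eq => f g; rewrite !mulEndE !outerE. Qed.

Lemma outer_linearl b : linear (fun a => outer a b).
Proof.
move=> c a a'; apply/esym/outer_eq => f g.
by rewrite addEndE scaleEndE !outerE addEndE scaleEndE lpolyP mulrDl scalerAl.
Qed.

Lemma outer_linearr a : linear (fun b => outer a b).
Proof.
move=> c b b'; apply/esym/outer_eq => f g.
by rewrite addEndE scaleEndE !outerE addEndE scaleEndE rpolyP mulrDr scalerAr.
Qed.

Lemma outerZr c a b : outer a (c *: b) = c *: outer a b.
Proof.
apply/esym/outer_eq => f g.
by rewrite !scaleEndE outerE -[c *: b g]addr0 rpolyP rpoly0 addr0 scalerAr.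
Qed.

Lemma lpolyX i : lpoly 'X_i = 'X_(lshift m i).
Proof. by rewrite /lpoly comp_mpolyXU -tnth_nth tnth_mktuple. Qed.
Lemma rpolyX i : rpoly 'X_i = 'X_(rshift n i).
Proof. by rewrite /rpoly comp_mpolyXU -tnth_nth tnth_mktuple. Qed.
Lemma lpolyM p q : lpoly (p * q) = lpoly p * lpoly q.
Proof. exact: rmorphM. Qed.
Lemma rpolyM p q : rpoly (p * q) = rpoly p * rpoly q.
Proof. exact: rmorphM. Qed.
Lemma lpoly1 : lpoly 1 = 1. Proof. exact: rmorph1. Qed.
Lemma rpoly1 : rpoly 1 = 1. Proof. exact: rmorph1. Qed.

End Outer.

Lemma mpoly_morph_eq (k : fieldType) N M (F G : {mpoly k[N]} -> {mpoly k[M]}) :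
  linear F -> linear G -> F 1 = 1 -> G 1 = 1 ->
  {morph F : p q / p * q} -> {morph G : p q / p * q} ->
  (forall i, F 'X_i = G 'X_i) -> F =1 G.
Proof.
move=> lF lG F1 G1 FM GM FGX.
have lin0 H : linear H -> H 0 = 0 :> {mpoly k[M]}.
  move=> lH; have /esym/eqP := lH 1 0 0; rewrite !scale1r addr0.
  by rewrite -subr_eq0 addrK => /eqP.
elim/mpolyind => [|c u p _ _ IH]; first by rewrite !lin0.
rewrite lF lG IH; congr (_ *: _ + _).
rewrite mpolyXE_id; apply: (big_ind (fun f => F f = G f)).
- by rewrite F1 G1.
- by move=> f g Ff Fg; rewrite FM GM Ff Fg.
move=> i _; elim: (u i) => [|e IHe]; first by rewrite expr0 F1 G1.
by rewrite exprS FM GM IHe FGX.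
Qed.

Section OuterGenerators.
Variables (k : fieldType) (n m : nat).

Section Left.
Variables (i : nat) (lt_i : (i.+1 < n)%N) (lt_inm : (i.+1 < n + m)%N).

Lemma swap_lpoly (p : {mpoly k[n]}) :
  swap lt_inm (lpoly m p) = lpoly m (swap lt_i p).
Proof.
apply: (mpoly_morph_eq (F := swap lt_inm \o @lpoly k n m)
                       (G := @lpoly k n m \o swap lt_i)) => /=.
- by move=> c f g; rewrite /= lpolyP swap_linear.
- by move=> c f g; rewrite /= swap_linear lpolyP.
- by rewrite lpoly1 swap1.
- by rewrite swap1 lpoly1.
- by move=> f g /=; rewrite lpolyM swapM.
- by move=> f g /=; rewrite swapM lpolyM.
move=> j; rewrite lpolyX !swapX lpolyX; congr 'X_ _.
rewrite (_ : lo lt_inm = lshift m (lo lt_i)); last exact: val_inj.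
rewrite (_ : hi lt_inm = lshift m (hi lt_i)); last exact: val_inj.
by apply/esym/inj_tperm/lshift_inj.
Qed.

Lemma swap_rpoly (p : {mpoly k[m]}) : swap lt_inm (rpoly n p) = rpoly n p.
Proof.
apply: (mpoly_morph_eq (F := swap lt_inm \o @rpoly k n m)
                       (G := @rpoly k n m)) => /=.
- by move=> c f g; rewrite /= rpolyP swap_linear.
- exact: rpolyP.
- by rewrite rpoly1 swap1.
- exact: rpoly1.
- by move=> f g /=; rewrite rpolyM swapM.
- exact: rpolyM.
move=> j; rewrite rpolyX !swapX tpermD //; apply/eqP => /(congr1 val) /= e.
  by move: (ltnW lt_i); rewrite e ltnNge leq_addr.
by move: lt_i; rewrite e ltnNge leq_addr.
Qed.

Lemma subX_lpoly : lpoly m ('X_(lo lt_i) - 'X_(hi lt_i)) =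
  'X_(lo lt_inm) - 'X_(hi lt_inm) :> {mpoly k[n + m]}.
Proof.
rewrite -scaleN1r addrC lpolyP !lpolyX scaleN1r addrC.
by congr ('X_ _ - 'X_ _); apply: val_inj.
Qed.

Lemma outer_divdiffl : outer (divdiff k lt_i) 1 = divdiff k lt_inm :> polyEnd k (n + m).
Proof.
apply/esym/outer_eq => f g; apply/esym/divdiff_uniq.
rewrite -subX_lpoly mulrA -lpolyM divdiffE swapM swap_lpoly swap_rpoly -mulrBl.
by rewrite -scaleN1r addrC lpolyP scaleN1r [in LHS]addrC.
Qed.

Lemma outer_divdiff_minusl :
  outer (divdiff_minus k lt_i) 1 = divdiff_minus k lt_inm.
Proof.
apply/esym/outer_eq => f g; rewrite !divdiff_minusE -outer_divdiffl.
have -> : 'X_(hi lt_inm) = lpoly m 'X_(hi lt_i) :> {mpoly k[n + m]}.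
  by rewrite lpolyX; congr 'X_ _; apply: val_inj.
have -> : 'X_(lo lt_inm) = lpoly m 'X_(lo lt_i) :> {mpoly k[n + m]}.
  by rewrite lpolyX; congr 'X_ _; apply: val_inj.
rewrite mulrA -lpolyM outerE mulrA -lpolyM -mulNr; congr (_ * _).
by rewrite -!scaleN1r -[in RHS](addr0 (_ *: _)) lpolyP lpoly0 addr0.
Qed.

End Left.

Section Right.
Variables (j : nat) (lt_j : (j.+1 < m)%N) (lt_nj : ((n + j).+1 < n + m)%N).

Lemma swap_rpolyr (p : {mpoly k[m]}) :
  swap lt_nj (rpoly n p) = rpoly n (swap lt_j p).
Proof.
apply: (mpoly_morph_eq (F := swap lt_nj \o @rpoly k n m)
                       (G := @rpoly k n m \o swap lt_j)) => /=.
- by move=> c f g; rewrite /= rpolyP swap_linear.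
- by move=> c f g; rewrite /= swap_linear rpolyP.
- by rewrite rpoly1 swap1.
- by rewrite swap1 rpoly1.
- by move=> f g /=; rewrite rpolyM swapM.
- by move=> f g /=; rewrite swapM rpolyM.
move=> l; rewrite rpolyX !swapX rpolyX; congr 'X_ _.
rewrite (_ : lo lt_nj = rshift n (lo lt_j)); last exact: val_inj.
rewrite (_ : hi lt_nj = rshift n (hi lt_j)); last first.
  by apply: val_inj; rewrite /= addnS.
by apply/esym/inj_tperm/rshift_inj.
Qed.

Lemma swap_lpolyr (p : {mpoly k[n]}) : swap lt_nj (lpoly m p) = lpoly m p.
Proof.
apply: (mpoly_morph_eq (F := swap lt_nj \o @lpoly k n m)
                       (G := @lpoly k n m)) => /=.
- by move=> c f g; rewrite /= lpolyP swap_linear.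
- exact: lpolyP.
- by rewrite lpoly1 swap1.
- exact: lpoly1.
- by move=> f g /=; rewrite lpolyM swapM.
- exact: lpolyM.
move=> l; rewrite lpolyX !swapX tpermD //; apply/eqP => /(congr1 val) /= e.
  by move: (ltn_ord l); rewrite -e ltnNge leq_addr.
by move: (ltn_ord l); rewrite -e ltnNge -addnS leq_addr.
Qed.

Lemma subX_rpoly : rpoly n ('X_(lo lt_j) - 'X_(hi lt_j)) =
  'X_(lo lt_nj) - 'X_(hi lt_nj) :> {mpoly k[n + m]}.
Proof.
rewrite -scaleN1r addrC rpolyP !rpolyX scaleN1r addrC.
by congr ('X_ _ - 'X_ _); apply: val_inj; rewrite //= addnS.
Qed.

Lemma outer_divdiffr : outer 1 (divdiff k lt_j) = divdiff k lt_nj :> polyEnd k (n + m).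
Proof.
apply/esym/outer_eq => f g; apply/esym/divdiff_uniq.
rewrite -subX_rpoly mulrCA -rpolyM divdiffE swapM swap_rpolyr swap_lpolyr.
rewrite -mulrBr; congr (_ * _).
by rewrite -scaleN1r addrC rpolyP scaleN1r [in LHS]addrC.
Qed.

Lemma outer_divdiff_minusr :
  outer 1 (divdiff_minus k lt_j) = divdiff_minus k lt_nj.
Proof.
apply/esym/outer_eq => f g; rewrite !divdiff_minusE -outer_divdiffr.
have -> : 'X_(hi lt_nj) = rpoly n 'X_(hi lt_j) :> {mpoly k[n + m]}.
  by rewrite rpolyX; congr 'X_ _; apply: val_inj; rewrite /= addnS.
have -> : 'X_(lo lt_nj) = rpoly n 'X_(lo lt_j) :> {mpoly k[n + m]}.
  by rewrite rpolyX; congr 'X_ _; apply: val_inj.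
rewrite mulrCA -rpolyM outerE mulrCA -rpolyM -mulrN; congr (_ * _).
by rewrite -!scaleN1r -[in RHS](addr0 (_ *: _)) rpolyP rpoly0 addr0.
Qed.

End Right.

Lemma inNC_outer (a : polyEnd k n) (b : polyEnd k m) :
  inNC a -> inNC b -> inNC (outer a b).
Proof.
move=> aNC bNC.
have {aNC} aNC : inNC (outer a (1 : polyEnd k m)).
  elim: {bNC} aNC => [i lt_i|i lt_i||c a1 a2 _ IH1 _ IH2|a1 a2 _ IH1 _ IH2].
  - by rewrite (outer_divdiffl lt_i (ltn_addr m lt_i)); apply: inNC_divdiff.
  - rewrite (outer_divdiff_minusl lt_i (ltn_addr m lt_i)).
    exact: inNC_divdiff_minus.
  - by rewrite outer1; apply: inNC_1.
  - by rewrite outer_linearl; apply: inNC_lin.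
  - by rewrite -[X in outer _ X]mulr1 outerM; apply: inNC_mul.
have {bNC} bNC : inNC (outer (1 : polyEnd k n) b).
  elim: bNC => [i lt_i|i lt_i||c a1 a2 _ IH1 _ IH2|a1 a2 _ IH1 _ IH2].
  - have lt_ni : ((n + i).+1 < n + m)%N by rewrite -addnS ltn_add2l.
    by rewrite (outer_divdiffr lt_i lt_ni); apply: inNC_divdiff.
  - have lt_ni : ((n + i).+1 < n + m)%N by rewrite -addnS ltn_add2l.
    by rewrite (outer_divdiff_minusr lt_i lt_ni); apply: inNC_divdiff_minus.
  - by rewrite outer1; apply: inNC_1.
  - by rewrite outer_linearr; apply: inNC_lin.
  - by rewrite -[X in outer X _]mulr1 outerM; apply: inNC_mul.
by rewrite -[a]mulr1 -[b]mul1r outerM; apply: inNC_mul.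
Qed.

End OuterGenerators.

Section Twist.
Variables (k : fieldType) (n : nat).
Local Notation P := {mpoly k[n]}.

Definition scale_vars (c : k) (p : P) : P :=
  p \mPo [tuple c *: 'X_i | i < n].

Lemma scale_vars_linear c : linear (scale_vars c).
Proof. by move=> d p q; rewrite /scale_vars linearP. Qed.

Definition scaleEnd (c : k) : polyEnd k n := mkEnd (scale_vars_linear c).

(* Conjugation by x_i |-> c x_i. By [twist_degree], it multiplies operators of
   degree d by c ^ (d / 2). *)
Definition twist (c : k) (b : polyEnd k n) : polyEnd k n :=
  scaleEnd c * b * scaleEnd c^-1.

Lemma scaleEndXm c u : scaleEnd c 'X_[u] = c ^+ mdeg u *: 'X_[u].
Proof.
rewrite /= /scale_vars comp_mpolyX [in RHS]mpolyXE_id mdegE -prodrXr.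
rewrite -scaler_prod; apply: eq_bigr => i _.
by rewrite tnth_mktuple exprZn.
Qed.

Lemma scaleEndM c d : scaleEnd (c * d) = scaleEnd c * scaleEnd d.
Proof.
apply: polyEnd_eqX => u.
by rewrite mulEndE !scaleEndXm EndZ scaleEndXm scalerA exprMn mulrC.
Qed.

Lemma scaleEnd1 : scaleEnd 1 = 1.
Proof.
by apply: polyEnd_eqX => u; rewrite scaleEndXm expr1n scale1r.
Qed.

Lemma twist1 c : c != 0 -> twist c 1 = 1.
Proof. by move=> c0; rewrite /twist mulr1 -scaleEndM divff // scaleEnd1. Qed.

Lemma twistM c a b : c != 0 -> twist c (a * b) = twist c a * twist c b.
Proof.
move=> c0; rewrite /twist -!mulrA (mulrA (scaleEnd c^-1)) -scaleEndM mulVf //.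
by rewrite scaleEnd1 mul1r.
Qed.

Lemma twistP c d a b : twist c (d *: a + b) = d *: twist c a + twist c b.
Proof. by rewrite /twist mulrDr mulrDl -scalerAr -scalerAl. Qed.

Lemma twist_degree c (d : int) (b : polyEnd k n) :
  c != 0 -> op_degree (d *+ 2) b -> twist c b = c ^ d *: b.
Proof.
move=> c0 bd; apply: polyEnd_eqX => u.
rewrite /twist !mulEndE scaleEndXm !EndZ scaleEndE.
have uh : 'X_[u] \is [in k[n], (mdeg u).-homog] by rewrite dhomogX.
have := bd _ _ uh; move: (b 'X_[u]) => p pd.
have -> : scaleEnd c p = \sum_(v <- msupp p) (p@_v * c ^+ mdeg v) *: 'X_[v].
  rewrite {1}[p]mpolyE [LHS](linear_sum (scaleEnd c)); apply: eq_bigr => v _.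
  by rewrite [LHS]EndZ scaleEndXm scalerA.
rewrite [X in _ = _ *: X]mpolyE !scaler_sumr; apply: eq_big_seq => v /pd e.
rewrite !scalerA; congr (_ *: _); rewrite mulrCA [RHS]mulrC; congr (_ * _).
have -> : d = (mdeg v)%:Z - (mdeg u)%:Z.
  by apply: (pmulrnI (ltn0Sn 1)); rewrite /= mulrnBl e addrC addKr.
by rewrite expfzDr // -invr_expz -!exprnP exprVn mulrC.
Qed.

Lemma scaleEnd_morph c p q : scaleEnd c (p * q) = scaleEnd c p * scaleEnd c q.
Proof. exact: rmorphM. Qed.

Lemma scaleEndX c i : scaleEnd c 'X_i = c *: 'X_i.
Proof. by rewrite scaleEndXm mdeg1 expr1. Qed.

Section Gens.
Variables (i : nat) (lt_i : (i.+1 < n)%N).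

Lemma swap_scale c p : swap lt_i (scaleEnd c p) = scaleEnd c (swap lt_i p).
Proof.
apply: (mpoly_morph_eq (F := swap lt_i \o scaleEnd c)
                       (G := scaleEnd c \o swap lt_i)) => //.
- by move=> d f g; rewrite /comp EndP swap_linear.
- by move=> d f g; rewrite /comp swap_linear EndP.
- by rewrite /comp [scaleEnd c 1]rmorph1 swap1.
- by rewrite /comp swap1 [LHS]rmorph1.
- by move=> f g; rewrite /comp scaleEnd_morph swapM.
- by move=> f g; rewrite /comp swapM scaleEnd_morph.
by move=> j; rewrite /comp scaleEndX swapX scaleEndX -[_ *: _]addr0 swap_linear
  swapX [swap _ 0]linear0 addr0.
Qed.

Lemma twist_divdiff c : c != 0 -> twist c (divdiff k lt_i) = c^-1 *: divdiff k lt_i.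
Proof.
move=> c0; apply/polyEndP => p; rewrite /twist !mulEndE scaleEndE.
apply: (scalerI c0); rewrite scalerA divff // scale1r.
apply: divdiff_uniq.
have -> : 'X_(lo lt_i) - 'X_(hi lt_i) =
    c^-1 *: scaleEnd c ('X_(lo lt_i) - 'X_(hi lt_i)).
  rewrite -scaleN1r addrC EndP !scaleEndX scalerA mulrC -scalerA -scalerDr.
  by rewrite scalerA mulVf // scale1r.
rewrite -scalerAl -scalerAr scalerA mulVf // scale1r -scaleEnd_morph divdiffE.
rewrite swap_scale -scaleN1r addrC EndP scaleN1r addrC.
by rewrite -mulEndE -[in LHS]mulEndE -scaleEndM divff // scaleEnd1.
Qed.

Lemma twist_divdiff_minus c :
  c != 0 -> twist c (divdiff_minus k lt_i) = c *: divdiff_minus k lt_i.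
Proof.
move=> c0; apply/polyEndP => p; rewrite /twist !mulEndE scaleEndE.
rewrite !divdiff_minusE -scaleN1r EndZ scaleN1r scaleEnd_morph scaleEndX scalerN; congr (- _).
rewrite -scalerAl; congr (_ *: (_ * _)).
have -> : 'X_(hi lt_i) * scaleEnd c^-1 p = c *: scaleEnd c^-1 ('X_(hi lt_i) * p).
  by rewrite scaleEnd_morph scaleEndX -scalerAl scalerA divff // scale1r.
have /polyEndP /(_ ('X_(hi lt_i) * p)) := twist_divdiff c0.
rewrite /twist !mulEndE scaleEndE !EndZ => ->.
by rewrite scalerA divff // scale1r.
Qed.

Lemma swap_homog e (p : P) : p \is e.-homog -> swap lt_i p \is e.-homog.
Proof.
move=> /dhomogP ph; apply/dhomogP => v; rewrite mcoeff_msupp mcoeff_sym.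
by rewrite -mcoeff_msupp => /ph; rewrite /= mdeg_mperm.
Qed.

Lemma op_degreeX d (a : polyEnd k n) :
  (forall u v, v \in msupp (a 'X_[u]) ->
    (mdeg v)%:Z *+ 2 = (mdeg u)%:Z *+ 2 + d) -> op_degree d a.
Proof.
move=> aX e p /dhomogP ph v; rewrite mcoeff_msupp [p]mpolyE.
rewrite [a _](linear_sum a) linear_sum /= => nz.
have [/hasP[u up nzu]|] := boolP (has (fun u => (p@_u * (a 'X_[u])@_v) != 0) (msupp p)).
  rewrite -(ph _ up); apply: aX; rewrite mcoeff_msupp.
  by apply: contra nzu => /eqP ->; rewrite mulr0.
move=> /hasPn all0; case/eqP: nz; rewrite big_seq big1 // => u /all0.
by rewrite negbK => /eqP e0; rewrite -[LHS]/((a _)@_v) EndZ mcoeffZ.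
Qed.

Lemma divdiff_degree : op_degree (-2) (divdiff k lt_i).
Proof.
pose D e (q : P) := if e is e'.+1 then q \is e'.-homog else q = 0.
have DM e e' (q r : P) : D e q -> r \is e'.-homog -> D (e + e')%N (q * r).
  case: e => [->|e]; last exact: dhomogM.
  by rewrite mul0r; case: e' => // e' _; apply: dhomog0.
have DD e (q r : P) : D e q -> D e r -> D e (q + r).
  by case: e => [-> ->|e]; [rewrite addr0 | apply: dhomogD].
pose H e (f : P) := f \is e.-homog /\ D e (divdiff k lt_i f).
have HM e e' f g : H e f -> H e' g -> H (e + e')%N (f * g).
  move=> [fh Df] [gh Dg]; split; first exact: dhomogM.
  rewrite divdiffM; apply: DD; first exact: DM.
  by rewrite addnC mulrC; apply: DM => //; apply: swap_homog.
have H1 : H 0%N 1.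
  split; first exact: dhomog1.
  by apply/esym/divdiff_uniq; rewrite swap1 subrr mulr0.
have HX j : H 1%N 'X_j.
  split; first by rewrite dhomogX /= mdeg1.
  have dX (g : k) : ('X_(lo lt_i) - 'X_(hi lt_i)) * g%:MP = 'X_j - swap lt_i 'X_j ->
      D 1%N (divdiff k lt_i 'X_j).
    move=> /divdiff_uniq e; rewrite /D (_ : divdiff k lt_i 'X_j = g%:MP) //.
    rewrite -[g%:MP]mulr1 mul_mpolyC.
    by apply: dhomogZ; apply: dhomog1.
  rewrite swapX in dX; case: tpermP dX => [->|->|_ _] dX.
  - by apply: (dX 1); rewrite mulr1.
  - by apply: (dX (-1)); rewrite mpolyCN mulrN1 opprB.
  - by apply: (dX 0); rewrite mulr0 subrr.
have HXu u : H (mdeg u) 'X_[u].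
  rewrite mdegE mpolyXE_id; apply: (big_ind2 H) => [|e f e' g He He'|j _] //.
    exact: HM.
  elim: (u j) => [|e IH]; first by rewrite expr0.
  by rewrite exprS -add1n; apply: HM.
apply: op_degreeX => u v; case: (HXu u) => _; case: (mdeg u) => [->|e].
  by rewrite msupp0.
move=> /dhomogP /[apply] /= ->; rewrite intS mulrnDl addrAC subrr add0r //.
Qed.

Lemma divdiff_minus_degree : op_degree 2 (divdiff_minus k lt_i).
Proof.
apply: op_degreeX => u v; rewrite divdiff_minusE (perm_mem (msuppN _)) -mpolyXD.
have qh : divdiff k lt_i 'X_[U_(hi lt_i) + u] \is (mdeg u).-homog.
  apply/dhomogP => w; have := divdiff_degree.
  move=> /(_ (mdeg (U_(hi lt_i) + u)%MM) _ _ w) /[apply].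
  rewrite dhomogX => /(_ (eqxx _)); rewrite mdegD mdeg1 add1n intS mulrnDl.
  by rewrite addrAC subrr add0r => /(pmulrnI (ltn0Sn 1)) [].
have xh : 'X_(lo lt_i) \is [in k[n], 1.-homog] by rewrite dhomogX /= mdeg1.
have /dhomogP := dhomogM xh qh; move=> /[apply] /= ->.
by rewrite add1n intS mulrnDl addrC.
Qed.

End Gens.

Lemma inNC_twist c (b : polyEnd k n) : c != 0 -> inNC b -> inNC (twist c b).
Proof.
move=> c0; elim => [i lt_i|i lt_i||d a1 a2 _ IH1 _ IH2|a1 a2 _ IH1 _ IH2].
- by rewrite twist_divdiff //; apply/inNC_scale/inNC_divdiff.
- by rewrite twist_divdiff_minus //; apply/inNC_scale/inNC_divdiff_minus.
- by rewrite twist1 //; apply: inNC_1.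
- by rewrite twistP; apply: inNC_lin.
- by rewrite twistM //; apply: inNC_mul.
Qed.

End Twist.

Section NCsystem.
Variables (k : fieldType) (nu : k) (nu_neq0 : nu != 0).

(* By [outer1], [outerM] and the lemmas [outer_divdiff...], this is the algebra
   map keeping the generators of the first factor and shifting those of the
   second one by n. *)
Definition NCtens1 n m (a : NC k n) (b : NC k m) : NC k (n + m) :=
  mkNC (inNC_outer (elimT (NC_predP a) (NC_valP a))
                   (elimT (NC_predP b) (NC_valP b))).

Lemma nuX_neq0 n : nu ^- n != 0.
Proof. by rewrite invr_eq0 expf_neq0. Qed.

Definition NCtwist n m (b : NC k m) : NC k m :=
  mkNC (inNC_twist (nuX_neq0 n) (elimT (NC_predP b) (NC_valP b))).

(* On homogeneous b this is nu ^ (- n deg(b) / 2) psi^1(a, b), by [NCtensE];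
   conjugation extends the formula linearly to all b. *)
Definition NCtens n m (a : NC k n) (b : NC k m) : NC k (n + m) :=
  NCtens1 a (NCtwist n b).

Definition NCsystem : tensorSystem k :=
  @TensorSystem k (NC k) (fun n d a => op_degree d a) NCtens.

Lemma NCtensE n m (d : int) (a : NC k n) (b : NC k m) :
  op_degree (d *+ 2) b ->
  NCtens a b = nu ^ (- (n%:Z * d)) *: NCtens1 a b.
Proof.
move=> bd; apply: val_inj; rewrite [LHS]/= (twist_degree (nuX_neq0 n) bd) outerZr.
by rewrite exprnN exprz_exp mulNr.
Qed.

Lemma NCtens_divdiffl :
  NCtens (NCd k (isT : (1 < 2)%N)) (1 : NC k 1) = NCd k (isT : (1 < 3)%N).
Proof.
apply: val_inj => /=; rewrite twist1 ?nuX_neq0 //.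
exact: (@outer_divdiffl k 2 1 0 isT isT).
Qed.

Lemma NCtens_divdiff_minusl :
  NCtens (NCdm k (isT : (1 < 2)%N)) (1 : NC k 1) = NCdm k (isT : (1 < 3)%N).
Proof.
apply: val_inj => /=; rewrite twist1 ?nuX_neq0 //.
exact: (@outer_divdiff_minusl k 2 1 0 isT isT).
Qed.

Lemma NCtens_divdiffr :
  NCtens (1 : NC k 1) (NCd k (isT : (1 < 2)%N)) =
  nu *: NCd k (isT : (2 < 3)%N).
Proof.
apply: val_inj => /=; rewrite twist_divdiff ?nuX_neq0 // expr1 invrK outerZr.
by rewrite (@outer_divdiffr k 1 2 0 isT isT).
Qed.

Lemma NCtens_divdiff_minusr :
  NCtens (1 : NC k 1) (NCdm k (isT : (1 < 2)%N)) =
  nu^-1 *: NCdm k (isT : (2 < 3)%N).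
Proof.
apply: val_inj => /=; rewrite twist_divdiff_minus ?nuX_neq0 // expr1 outerZr.
by rewrite (@outer_divdiff_minusr k 1 2 0 isT isT).
Qed.

End NCsystem.

(* The images of the four local generators are those of [NCsystem nu], by
   [NCtens_divdiffl], [NCtens_divdiffr] and their minus versions. *)
Definition nu_standard (k : fieldType) (C : tensorSystem k) (nu : k) : Prop :=
  exists d dm : alg C 2,
    [/\ has_deg C (-2) d /\ has_deg C 2 dm,
        d * d = 0, dm * dm = 0, d * dm + dm * d = 1
      & exists phi : {lrmorphism alg C 3 -> NC k 3},
        [/\ bijective phi /\
            forall e (a : alg C 3), has_deg C e a <-> op_degree e (phi a),
            phi (tens C d (1 : alg C 1)) = NCd k (isT : (1 < 3)%N),
            phi (tens C (1 : alg C 1) d) = nu *: NCd k (isT : (2 < 3)%N),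
            phi (tens C dm (1 : alg C 1)) = NCdm k (isT : (1 < 3)%N)
          & phi (tens C (1 : alg C 1) dm) = nu^-1 *: NCdm k (isT : (2 < 3)%N)]].

(* Main.v *)
From HB Require Import structures.
Require Import Defs.
From mathcomp Require Import all_boot all_order all_fingroup all_algebra.
From mathcomp Require Import boolp mpoly zify ring.

Set Implicit Arguments.
Unset Strict Implicit.
Unset Printing Implicit Defensive.

Import Order.TTheory GRing.Theory Num.Theory.
Local Open Scope ring_scope.

(** Write D_i and D_i^- for the images in the n-strand algebra A_n of C of the
two distinguished elements of A_2, placed on the strands i and i + 1.  On the
standard side they correspond to nu^i times the divided difference of index i
and to nu^-i times its companion.  Every relation of the three-strand algebra
is inherited by the D_i, and elements on disjoint strands commute.  Since A_n is
a full matrix algebra End(W_n), it suffices to identify W_n with a module of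
polynomials in such a way that the D_i become divided differences.

The key is a straightening property ([ladder_balanced]): in three strands,
D_1 D_2^- and D_2 D_1^- are combinations of products in which all raising
factors D^- stand to the left of equally many lowering factors D
([nilHecke_straighten_up], [nilHecke_straighten_down]).  So let v be a vector of
lowest degree in W_n and let N be the span of the vectors obtained from (v, 1)
in the direct sum of W_n and k[x_1, ..., x_n] by applying raising operators
diagonally.  Straightening makes N stable under the lowering operators, with
(v, 1) as its only vector of lowest degree up to scalars ([level_lower]).

The projection of N to W_n is injective ([pair_level_inj]).  Indeed, if (0, p)
is in N then, by induction on the degree, all divided differences kill p, so p
is symmetric.  But the 0-Hecke operators z_i, the products of the i-th lowering
and raising operators, fix p, while a suitable product of them kills everything
in the image of a raising operator.  The projection of N to k[x] is the module H
generated by 1, the analogue of the harmonic polynomials.  Multiplying elements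
of H for m strands by the elementary symmetric polynomials e_j(x_1, ..., x_m)
gives elements of H for m + 1 strands, and this yields n! independent elements
([harm_family]).  As W_n has dimension n! ([dim_qfact], by putting q = 1), N is
the graph of an isomorphism from W_n to H.

It remains to see that every endomorphism of W_n corresponds to exactly one
element of the algebra NC_n.  Existence ([all_matched]): the product z of the
z_i along a word for the longest permutation is a rank one projection of H onto
the constants, and 1 - z is a combination of elements a D_i.  So a = a z + (a
combination of a' D_i), and iterating this, the words in the D_i become zero.
Uniqueness: k[x] is spanned by the products of a symmetric polynomial and an
element of H ([homog_symm_harm]), and NC_n is linear over symmetric polynomials.
The resulting isomorphisms from A_n to NC_n send generators to generators, hence
are compatible with tensor products. *)

(** * Divided differences *)

Lemma EndN (k : fieldType) N (a : polyEnd k N) p : a (- p) = - a p.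
Proof. by rewrite -scaleN1r EndZ scaleN1r. Qed.

Lemma EndB (k : fieldType) N (a : polyEnd k N) p q : a (p - q) = a p - a q.
Proof. by rewrite EndD EndN. Qed.

Lemma End_sum (k : fieldType) N (a : polyEnd k N) I (r : seq I) (F : I ->
  {mpoly k[N]}) :
  a (\sum_(i <- r) F i) = \sum_(i <- r) a (F i).
Proof. exact: (big_morph a (EndD a) (End0 a)). Qed.

Section OneDifference.
Variables (k : fieldType) (n i : nat) (lt_i : (i.+1 < n)%N).
Local Notation P := {mpoly k[n]}.
Local Notation d := (divdiff k lt_i).
Local Notation x := ('X_(lo lt_i) : P).
Local Notation y := ('X_(hi lt_i) : P).
Implicit Types p q : P.

Lemma swapK p : swap lt_i (swap lt_i p) = p.
Proof. by rewrite /swap -msymMm tperm2 msym1m. Qed.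

Lemma swapB p q : swap lt_i (p - q) = swap lt_i p - swap lt_i q.
Proof. exact: msymB. Qed.

Lemma divdiff_eqP p : d p = 0 <-> swap lt_i p = p.
Proof.
split=> [dp0 | sp].
  by have /eqP := divdiffE lt_i p; rewrite -[divdiff_fun _ _]/(d p) dp0 mulr0
    eq_sym subr_eq0 => /eqP.
by apply/esym/divdiff_uniq; rewrite sp subrr mulr0.
Qed.

Lemma divdiff_swap p : swap lt_i (d p) = d p.
Proof.
apply/(mulfI (subX_neq0 k lt_i)).
rewrite [RHS]divdiffE.
have := congr1 (swap lt_i) (divdiffE lt_i p).
rewrite swapM !swapB !swapX tpermL tpermR swapK -opprB mulNr => /(congr1 -%R).
by rewrite opprK opprB.
Qed.

Lemma divdiff_divdiff p : d (d p) = 0.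
Proof. by apply/divdiff_eqP/divdiff_swap. Qed.

Lemma divdiff_invM p q : d q = 0 -> d (q * p) = q * d p.
Proof. by move=> dq0; rewrite divdiffM dq0 mul0r add0r ((divdiff_eqP q).1 dq0). Qed.

Lemma divdiff_lo : d x = 1.
Proof. by apply/esym/divdiff_uniq; rewrite swapX tpermL mulr1. Qed.

Lemma divdiff_hi : d y = -1.
Proof. by apply/esym/divdiff_uniq; rewrite swapX tpermR mulrN1 opprB. Qed.

Lemma divdiff_other j : j != lo lt_i -> j != hi lt_i -> d 'X_j = 0.
Proof. by move=> jlo jhi; apply/divdiff_eqP; rewrite swapX tpermD // eq_sym. Qed.

Lemma divdiff_loM p : d (x * p) = y * d p + p.
Proof. by rewrite divdiffM divdiff_lo swapX tpermL mul1r addrC. Qed.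

Lemma divdiff_hiM p : d (y * p) = x * d p - p.
Proof. by rewrite divdiffM divdiff_hi swapX tpermR mulN1r addrC. Qed.

Lemma divdiff_1 : d 1 = 0.
Proof. by apply/divdiff_eqP; rewrite swap1. Qed.

(** Normal form in which variables stand to the left of the divided
difference; the identities below are compared in this form. *)
Lemma divdiff_minus_raise p : divdiff_minus k lt_i p = x * (p - x * d p).
Proof. by rewrite divdiff_minusE divdiff_hiM; ring. Qed.

End OneDifference.

(** After clearing denominators both sides are the antisymmetrization of [p]
over the six permutations of three variables, which is visibly symmetric in the
two generators. The statement is over an abstract ring because the computation
only uses the reflections. *)
Lemma braid_antisym (R : comNzRingType) (s1 s2 d1 d2 : R -> R) (a b c p : R) :
  {morph s1 : u v / u - v} -> {morph s2 : u v / u - v} ->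
  {morph s1 : u v / u * v} -> {morph s2 : u v / u * v} ->
  c = a + b -> s1 b = c -> s2 a = c -> involutive s1 -> involutive s2 ->
  (forall q, s1 (s2 (s1 q)) = s2 (s1 (s2 q))) ->
  (forall q, a * d1 q = q - s1 q) -> (forall q, b * d2 q = q - s2 q) ->
  (forall q, s1 (d1 q) = d1 q) -> (forall q, s2 (d2 q) = d2 q) ->
  a * b * c * d1 (d2 (d1 p)) = a * b * c * d2 (d1 (d2 p)).
Proof.
move=> s1B s2B s1M s2M cE s1b s2a s1K s2K braid da db s1d s2d.
have s1c : s1 c = b by rewrite -s1b s1K.
have s2c : s2 c = a by rewrite -s2a s2K.
have expand (x y z : R) (s t d e : R -> R) q :
    {morph s : u v / u - v} -> {morph s : u v / u * v} ->
    {morph t : u v / u - v} -> {morph t : u v / u * v} ->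
    z - y = x -> s y = z -> t x = z -> s z = y ->
    (forall q, x * d q = q - s q) -> (forall q, y * e q = q - t q) ->
    (forall q, s (d q) = d q) ->
    x * y * z * d (e (d q)) = q - s q - (t q - t (s q)) + (s (t q) - s (t (s q))).
  move=> sB sM tB tM zyx sy tx sz dE eE sd.
  transitivity (y * z * (x * d (e (d q)))); first by ring.
  rewrite dE mulrBr.
  have -> : y * z * e (d q) = z * (y * e (d q)) by ring.
  have -> : y * z * s (e (d q)) = y * s (y * e (d q)) by rewrite sM sy; ring.
  rewrite eE sB sd -[X in z * (_ - t X)]/(d q).
  have -> : z * (d q - t (d q)) = z * d q - t (x * d q) by rewrite tM tx; ring.
  have -> : y * (d q - s (t (d q))) = y * d q - s (t (x * d q)).
    by rewrite tM tx sM sz; ring.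
  have -> : z * d q = x * d q + y * d q by rewrite -zyx; ring.
  by rewrite dE !(tB, sB); ring.
rewrite (expand a b c s1 s2 d1 d2 p) //; last by rewrite cE addrK.
have -> : a * b * c = b * a * c by ring.
rewrite (expand b a c s2 s1 d2 d1 p) //; last by rewrite cE addrC addKr.
by rewrite braid; ring.
Qed.

Section NilHecke3.
Variables (R : comNzRingType) (x1 x2 x3 : R) (d1 d2 m1 m2 : R -> R).

(** The commutation rules of three variables and two divided differences that
are used to compare words in the operators; [m1] and [m2] are the raising
companions. *)
Record nilHecke3 : Prop := NilHecke3 {
  nh_d1B : {morph d1 : p q / p - q};
  nh_d2B : {morph d2 : p q / p - q};
  nh_d1d1 : forall p, d1 (d1 p) = 0;
  nh_d2d2 : forall p, d2 (d2 p) = 0;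
  nh_braid : forall p, d1 (d2 (d1 p)) = d2 (d1 (d2 p));
  nh_d1x1 : forall p, d1 (x1 * p) = x2 * d1 p + p;
  nh_d1x2 : forall p, d1 (x2 * p) = x1 * d1 p - p;
  nh_d1x3 : forall p, d1 (x3 * p) = x3 * d1 p;
  nh_d2x1 : forall p, d2 (x1 * p) = x1 * d2 p;
  nh_d2x2 : forall p, d2 (x2 * p) = x3 * d2 p + p;
  nh_d2x3 : forall p, d2 (x3 * p) = x2 * d2 p - p;
  nh_m1 : forall p, m1 p = x1 * (p - x1 * d1 p);
  nh_m2 : forall p, m2 p = x2 * (p - x2 * d2 p)
}.

Hypothesis nh : nilHecke3.

Let d10 : d1 0 = 0. Proof. by have := nh_d1B nh 0 0; rewrite !subrr. Qed.
Let d20 : d2 0 = 0. Proof. by have := nh_d2B nh 0 0; rewrite !subrr. Qed.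
Let d1N p : d1 (- p) = - d1 p.
Proof. by rewrite -[in LHS]sub0r (nh_d1B nh) d10 sub0r. Qed.
Let d2N p : d2 (- p) = - d2 p.
Proof. by rewrite -[in LHS]sub0r (nh_d2B nh) d20 sub0r. Qed.
Let d1D p q : d1 (p + q) = d1 p + d1 q.
Proof. by rewrite -[in LHS](opprK q) (nh_d1B nh) d1N opprK. Qed.
Let d2D p q : d2 (p + q) = d2 p + d2 q.
Proof. by rewrite -[in LHS](opprK q) (nh_d2B nh) d2N opprK. Qed.
Let push := (d1D, d2D, d1N, d2N, nh_d1x1 nh, nh_d1x2 nh, nh_d1x3 nh,
  nh_d2x1 nh, nh_d2x2 nh, nh_d2x3 nh, nh_d1d1 nh, nh_d2d2 nh, d10, d20).

(** The two straightening identities are the heart of the argument: on the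
right each word has its raising operators on the left and equally many lowering
operators on the right. They are verified by moving all variables to the
left. *)
Lemma nilHecke_straighten_up p :
  d1 (m2 p) = - p + m1 (d1 p) + m2 (d2 p) + m1 (d2 p).
Proof. by rewrite !(nh_m1 nh, nh_m2 nh) !push; ring. Qed.

Lemma nilHecke_straighten_down p :
  d2 (m1 p) = m1 (d2 p)
    + (m1 (m2 (d1 (d2 p) - d2 (d1 p))) - m2 (m1 (d1 (d2 p) - d2 (d1 p))))
    + m1 (m2 (m1 (d1 (d2 (d1 p))))) *+ 2.
Proof.
rewrite !(nh_m1 nh, nh_m2 nh) !push -!(nh_braid nh) !push.
ring.
Qed.

Lemma nilHecke_zero_hecke_braid p
    (z1 := fun q => d1 (m1 q)) (z2 := fun q => d2 (m2 q)) :
  z1 (z2 (z1 p)) = z2 (z1 (z2 p)).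
Proof.
rewrite /z1 /z2 !(nh_m1 nh, nh_m2 nh) !push -!(nh_braid nh).
ring.
Qed.

End NilHecke3.

Section AdjacentDifferences.
Variables (k : fieldType) (n i : nat).
Variables (lt_i : (i.+1 < n)%N) (lt_j : (i.+2 < n)%N).
Local Notation P := {mpoly k[n]}.
Local Notation d1 := (divdiff k lt_i).
Local Notation d2 := (divdiff k lt_j).
Local Notation m1 := (divdiff_minus k lt_i).
Local Notation m2 := (divdiff_minus k lt_j).
Local Notation s1 := (swap lt_i).
Local Notation s2 := (swap lt_j).
Local Notation x1 := ('X_(lo lt_i) : P).
Local Notation x2 := ('X_(hi lt_i) : P).
Local Notation x3 := ('X_(hi lt_j) : P).
Implicit Types p q : P.

Let lo2 : lo lt_j = hi lt_i. Proof. exact: val_inj. Qed.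

Lemma divdiff1_x3 p : d1 (x3 * p) = x3 * d1 p.
Proof.
apply: divdiff_invM; apply: divdiff_other; apply/eqP => /(congr1 val) /= /eqP.
  by rewrite gtn_eqF // leqnSn.
by rewrite gtn_eqF.
Qed.

Lemma divdiff2_x1 p : d2 (x1 * p) = x1 * d2 p.
Proof.
apply: divdiff_invM; apply: divdiff_other; apply/eqP => /(congr1 val) /= /eqP.
  by rewrite ltn_eqF.
by rewrite ltn_eqF // leqnSn.
Qed.

Lemma divdiff2_x2 p : d2 (x2 * p) = x3 * d2 p + p.
Proof. by rewrite -lo2 divdiff_loM. Qed.

Lemma divdiff2_x3 p : d2 (x3 * p) = x2 * d2 p - p.
Proof. by rewrite divdiff_hiM lo2. Qed.

Lemma swap_braid p : s1 (s2 (s1 p)) = s2 (s1 (s2 p)).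
Proof.
rewrite /swap -!msymMm; congr (msym _ p); rewrite lo2.
have conj (a b c e : 'I_n) :
    (tperm a b * (tperm c e * tperm a b))%g = tperm (tperm a b c) (tperm a b e).
  by rewrite -tpermJ conjgE tpermV.
by rewrite !conj tpermR tpermL !tpermD // -val_eqE /=; lia.
Qed.

Lemma divdiff_braid p : d1 (d2 (d1 p)) = d2 (d1 (d2 p)).
Proof.
have x1x3 : 'X_(lo lt_i) != 'X_(hi lt_j) :> P.
  rewrite -subr_eq0; apply/eqP => e; move: (subX_neq0 k lt_i).
  have := congr1 d1 e; rewrite EndB divdiff_lo -[x3]mulr1 divdiff1_x3.
  by rewrite divdiff_1 mulr0 subr0 End0 => /eqP; rewrite oner_eq0.
have nz : (x1 - x2) * (x2 - x3) * (x1 - x3) != 0.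
  apply: mulf_neq0; last by rewrite subr_eq0.
  by apply: mulf_neq0; [|rewrite -lo2]; apply: subX_neq0.
apply: (mulfI nz).
apply: (@braid_antisym _ s1 s2 d1 d2 (x1 - x2) (x2 - x3)).
- exact: swapB.
- exact: swapB.
- exact: swapM.
- exact: swapM.
- by ring.
- by rewrite swapB !swapX tpermR tpermD // -val_eqE /=; lia.
- by rewrite swapB !swapX -lo2 tpermL tpermD // -val_eqE /=; lia.
- exact: swapK.
- exact: swapK.
- exact: swap_braid.
- exact: divdiffE.
- by move=> q; rewrite -lo2; apply: divdiffE.
- exact: divdiff_swap.
- exact: divdiff_swap.
Qed.

Lemma adjacent_nilHecke3 : nilHecke3 x1 x2 x3 d1 d2 m1 m2.
Proof.
split.
- exact: EndB.
- exact: EndB.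
- exact: divdiff_divdiff.
- exact: divdiff_divdiff.
- exact: divdiff_braid.
- exact: divdiff_loM.
- exact: divdiff_hiM.
- exact: divdiff1_x3.
- exact: divdiff2_x1.
- exact: divdiff2_x2.
- exact: divdiff2_x3.
- exact: divdiff_minus_raise.
- by move=> q; rewrite divdiff_minus_raise lo2.
Qed.

Lemma straighten_up p : d1 (m2 p) = - p + m1 (d1 p) + m2 (d2 p) + m1 (d2 p).
Proof. by apply: (nilHecke_straighten_up adjacent_nilHecke3). Qed.

Lemma straighten_down p :
  d2 (m1 p) = m1 (d2 p)
    + (m1 (m2 (d1 (d2 p) - d2 (d1 p))) - m2 (m1 (d1 (d2 p) - d2 (d1 p))))
    + m1 (m2 (m1 (d1 (d2 (d1 p))))) *+ 2.
Proof. by apply: (nilHecke_straighten_down adjacent_nilHecke3). Qed.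

Lemma zero_hecke_braid p (z1 := fun q => d1 (m1 q)) (z2 := fun q => d2 (m2 q)) :
  z1 (z2 (z1 p)) = z2 (z1 (z2 p)).
Proof. by apply: (nilHecke_zero_hecke_braid adjacent_nilHecke3). Qed.
End AdjacentDifferences.

(** * Straightening and lowest weight modules *)

Section LinearSpan.
Variables (k : fieldType) (V : lmodType k).

Inductive lspan (S : V -> Prop) : V -> Prop :=
| lspan0 : lspan S 0
| lspan_cons c u w of S u & lspan S w : lspan S (c *: u + w).

Lemma lspan_in (S : V -> Prop) u : S u -> lspan S u.
Proof. by move=> Su; rewrite -[u]addr0 -[u]scale1r; apply: lspan_cons (lspan0 S). Qed.

Lemma lspan_lin (S : V -> Prop) c u w : lspan S u -> lspan S w -> lspan S (c *: u + w).
Proof.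
move=> Su Sw; elim: Su c => [|d t t' St _ IH] c; first by rewrite scaler0 add0r.
by rewrite scalerDr scalerA -addrA; apply: lspan_cons => //; apply: IH.
Qed.

Lemma lspanD (S : V -> Prop) u w : lspan S u -> lspan S w -> lspan S (u + w).
Proof. by move=> Su Sw; rewrite -[u]scale1r; apply: lspan_lin. Qed.

Lemma lspanZ (S : V -> Prop) c u : lspan S u -> lspan S (c *: u).
Proof. by move=> Su; rewrite -[_ *: _]addr0; apply: lspan_lin (lspan0 S). Qed.

Lemma lspan_sum (S : V -> Prop) I (r : seq I) (Q : pred I) (F : I -> V) :
  (forall i, Q i -> lspan S (F i)) -> lspan S (\sum_(i <- r | Q i) F i).
Proof. by move=> SF; apply: big_ind => //; [apply: lspan0 | apply: lspanD]. Qed.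
End LinearSpan.

Lemma lspan_map (k : fieldType) (U V : lmodType k) (f : U -> V)
    (S : U -> Prop) (S' : V -> Prop) :
  linear f -> (forall u, S u -> lspan S' (f u)) ->
  forall u, lspan S u -> lspan S' (f u).
Proof.
move=> f_lin SS' u; elim=> [|c t w /SS' St _ IH].
  have := f_lin (-1) 0 0; rewrite scaler0 addr0 scaleN1r addNr => ->.
  exact: lspan0.
by rewrite f_lin; apply: lspan_lin.
Qed.

Section LowestWeight.
Variables (k : fieldType) (E : algType k) (D Dm : nat -> E).

(** Combinations of words Dm ... Dm D ... D with as many raising as lowering
factors, built from the inside. *)
Inductive balanced : E -> Prop :=
| balanced1 : balanced 1
| balanced_lin c f g of balanced f & balanced g : balanced (c *: f + g)
| balanced_wrap a b f of balanced f : balanced (Dm a * f * D b).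

Lemma balanced0 : balanced 0.
Proof.
by rewrite -(addNr 1) -scaleN1r; apply: balanced_lin; apply: balanced1.
Qed.

Lemma balancedD f g : balanced f -> balanced g -> balanced (f + g).
Proof. by move=> ? ?; rewrite -[f]scale1r; apply: balanced_lin. Qed.

Lemma balancedZ c f : balanced f -> balanced (c *: f).
Proof. by move=> ?; rewrite -[_ *: _]addr0; apply: balanced_lin balanced0. Qed.

Lemma balancedN f : balanced f -> balanced (- f).
Proof. by move=> ?; rewrite -scaleN1r; apply: balancedZ. Qed.

Variables (V : lmodType k) (act : E -> V -> V) (v : V).
Hypothesis act_linear : forall a, linear (act a).
Hypothesis act_linearl : forall u, linear (act^~ u).
Hypothesis actM : forall a b u, act (a * b) u = act a (act b u).
Hypothesis act1 : forall u, act 1 u = u.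
Hypothesis act_v : forall i, act (D i) v = 0.
Hypothesis straighten : forall i j, balanced (D i * Dm j).

(** Vectors obtained from the lowest weight vector by exactly [r] raising
steps. *)
Fixpoint level (r : nat) : V -> Prop :=
  if r is s.+1 then lspan (fun u => exists i w, level s w /\ u = act (Dm i) w)
  else lspan (eq v).

Lemma act0 a : act a 0 = 0.
Proof.
by have := act_linear a (-1) 0 0; rewrite scaler0 addr0 scaleN1r addNr.
Qed.

Lemma level0 r : level r 0. Proof. by case: r => [|r]; apply: lspan0. Qed.

Lemma level_lin r c u w : level r u -> level r w -> level r (c *: u + w).
Proof. by case: r => [|r]; apply: lspan_lin. Qed.

Lemma levelZ r c u : level r u -> level r (c *: u).
Proof. by case: r => [|r]; apply: lspanZ. Qed.

Lemma level_raise r i u : level r u -> level r.+1 (act (Dm i) u).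
Proof. by move=> ru; apply: lspan_in; exists i, u. Qed.

Let lowered r u : Prop :=
  forall i, if r is s.+1 then level s (act (D i) u) else act (D i) u = 0.

(** A balanced word first lowers and then raises by the same number of steps,
so it never needs the lowering property beyond level [r]. *)
Lemma lowered_balanced f : balanced f -> forall r,
  (forall s u, (s <= r)%N -> level s u -> lowered s u) ->
  forall u, level r u -> level r (act f u).
Proof.
elim=> [|c g h _ IHg _ IHh|a b g _ IHg] r low u ru; first by rewrite act1.
  by rewrite act_linearl; apply: level_lin; [apply: IHg | apply: IHh].
rewrite !actM; case: r low ru => [|r] low ru.
  by rewrite (low 0 u (leqnn _) ru b) !act0; apply: level0.
apply: level_raise; apply: IHg; last exact: (low r.+1 u (leqnn _) ru b).
by move=> s t sr; apply: low; rewrite leqW.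
Qed.

(** By induction on the level: straightening turns a lowering operator applied
to a raised vector of level [r] into a balanced operator on that vector. *)
Lemma level_lowered r u : level r u -> lowered r u.
Proof.
elim/ltn_ind: r u => -[|r] IH u; elim=> [|c t w].
- by move=> i; rewrite act0.
- by move=> <- _ IHw i; rewrite act_linear act_v scaler0 add0r IHw.
- by move=> i; rewrite act0; apply: level0.
move=> [j [t' [rt ->]]] _ IHw i; rewrite act_linear; apply: level_lin (IHw i).
rewrite -actM; apply: lowered_balanced (straighten i j) _ _ _ rt.
by move=> s x sr; apply: IH; rewrite ltnS.
Qed.

Lemma level0_lower i u : level 0 u -> act (D i) u = 0.
Proof. by move=> /level_lowered /(_ i). Qed.

Lemma level_lower r i u : level r.+1 u -> level r (act (D i) u).
Proof. by move=> /level_lowered /(_ i). Qed.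

End LowestWeight.

(** The relations between lowering operators [D] and raising operators [Dm] on
[n] strands that suffice for straightening; those with [nu] are the
straightening identities for adjacent indices, rescaled by powers of [nu]. *)
Record ladder (k : fieldType) (E : algType k) (nu : k) (n : nat)
    (D Dm : nat -> E) : Prop := Ladder {
  ladder_out : forall i, (n <= i.+1)%N -> D i = 0 /\ Dm i = 0;
  ladder_diag : forall i, (i.+1 < n)%N -> D i * Dm i = 1 - Dm i * D i;
  ladder_far : forall i j, (i.+1 < j)%N || (j.+1 < i)%N ->
    D i * Dm j = Dm j * D i;
  ladder_up : forall i, (i.+2 < n)%N ->
    D i * Dm i.+1 = nu^-1 *: (- 1 + Dm i * D i + Dm i.+1 * D i.+1
                              + nu^-1 *: (Dm i * D i.+1));
  ladder_down : forall i, (i.+2 < n)%N ->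
    D i.+1 * Dm i = Dm i * D i.+1
      + nu *: ((Dm i * Dm i.+1 - Dm i.+1 * Dm i) *
               (D i * D i.+1 - D i.+1 * D i)
               + (Dm i * Dm i.+1 * Dm i * (D i * D i.+1 * D i)) *+ 2)
}.

Lemma ladder_balanced (k : fieldType) (E : algType k) nu n (D Dm : nat -> E) :
  ladder nu n D Dm -> forall i j, balanced D Dm (D i * Dm j).
Proof.
move=> L i j.
have bal2 a b : balanced D Dm (Dm a * D b).
  by rewrite -[Dm a]mulr1; apply/balanced_wrap/balanced1.
have bal4 a b c d : balanced D Dm (Dm a * Dm b * (D c * D d)).
  by rewrite mulrA -(mulrA (Dm a) (Dm b)); apply: balanced_wrap.
have bal6 a b c d e f : balanced D Dm (Dm a * Dm b * Dm c * (D d * D e * D f)).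
  by rewrite mulrA -2!(mulrA (Dm a)); apply: balanced_wrap.
have [le_ni | lt_in] := leqP n i.+1.
  by rewrite (ladder_out L le_ni).1 mul0r; apply: balanced0.
have [le_nj | lt_jn] := leqP n j.+1.
  by rewrite (ladder_out L le_nj).2 mulr0; apply: balanced0.
have [far | near] := boolP ((i.+1 < j)%N || (j.+1 < i)%N).
  by rewrite (ladder_far L).
have : [|| j == i, j == i.+1 | i == j.+1] by lia.
case/or3P => /eqP e; subst.
- rewrite (ladder_diag L) //; apply: balancedD; first exact: balanced1.
  exact/balancedN/bal2.
- rewrite (ladder_up L) //; apply/balancedZ.
  do ![apply: balancedD]; rewrite ?bal2 //; first exact/balancedN/balanced1.
  exact/balancedZ.
rewrite (ladder_down L) //; apply: balancedD => //; apply/balancedZ.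
rewrite mulrBl !mulrBr mulr2n.
by do ![apply: balancedD || apply: balancedN].
Qed.

Lemma ladder_pair (k : fieldType) (E F : algType k) nu n
    (D Dm : nat -> E) (D' Dm' : nat -> F) :
  ladder nu n D Dm -> ladder nu n D' Dm' ->
  ladder (E := (E * F)%type) nu n (fun i => (D i, D' i)) (fun i => (Dm i, Dm' i)).
Proof.
move=> L L'; split=> [i ni|i ni|i j ij|i ni|i ni].
- by have [-> ->] := ladder_out L ni; have [-> ->] := ladder_out L' ni.
- by congr (_, _); rewrite (ladder_diag L, ladder_diag L').
- by congr (_, _); rewrite (ladder_far L, ladder_far L').
- by congr (_, _); rewrite (ladder_up L, ladder_up L').
- by congr (_, _); rewrite (ladder_down L, ladder_down L').
Qed.

Section TotalOperators.
Variables (k : fieldType) (n : nat).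
Local Notation P := {mpoly k[n]}.

(** Indexing by all natural numbers, with 0 out of range, avoids carrying the
proofs that an index is in range. *)
Definition ddiff i : polyEnd k n :=
  if @idP (i.+1 < n)%N is ReflectT lt_i then divdiff k lt_i else 0.
Definition ddiffm i : polyEnd k n :=
  if @idP (i.+1 < n)%N is ReflectT lt_i then divdiff_minus k lt_i else 0.

Lemma ddiffE i (lt_i : (i.+1 < n)%N) : ddiff i = divdiff k lt_i.
Proof.
by rewrite /ddiff; case: {-}_ / idP => // lt_i'; rewrite (bool_irrelevance lt_i lt_i').
Qed.

Lemma ddiffmE i (lt_i : (i.+1 < n)%N) : ddiffm i = divdiff_minus k lt_i.
Proof.
by rewrite /ddiffm; case: {-}_ / idP => // lt_i'; rewrite (bool_irrelevance lt_i lt_i').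
Qed.

Lemma ddiff_out i : (n <= i.+1)%N -> ddiff i = 0.
Proof. by rewrite /ddiff; case: {-}_ / idP => // lt_i; rewrite leqNgt lt_i. Qed.

Lemma ddiffm_out i : (n <= i.+1)%N -> ddiffm i = 0.
Proof. by rewrite /ddiffm; case: {-}_ / idP => // lt_i; rewrite leqNgt lt_i. Qed.

Lemma ddiff_diag i : (i.+1 < n)%N -> ddiff i * ddiffm i = 1 - ddiffm i * ddiff i.
Proof.
move=> lt_i; rewrite ddiffE ddiffmE; apply/polyEndP => p.
rewrite addEndE oppEndE oneEndE !mulEndE !divdiff_minus_raise divdiff_divdiff.
rewrite mulr0 subr0 divdiff_loM EndB divdiff_loM divdiff_divdiff.
by rewrite mulr0 add0r subrr mulr0 add0r.
Qed.

Section Far.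
Variables (i j : nat) (lt_i : (i.+1 < n)%N) (lt_j : (j.+1 < n)%N).
Hypothesis far : (i.+1 < j)%N || (j.+1 < i)%N.

Lemma swap_far (p : P) : swap lt_i (swap lt_j p) = swap lt_j (swap lt_i p).
Proof.
rewrite /swap -!msymMm; congr (msym _ p); apply/commgP/conjg_fixP.
by rewrite tpermJ !tpermD // -val_eqE /=; lia.
Qed.

Lemma divdiff_far_fix a : (val a == j) || (val a == j.+1) ->
  divdiff k lt_i 'X_a = 0.
Proof. by move=> /= aj; apply: divdiff_other; rewrite -val_eqE /=; lia. Qed.

Lemma divdiff_far_lo (p : P) :
  divdiff k lt_i ('X_(lo lt_j) * p) = 'X_(lo lt_j) * divdiff k lt_i p.
Proof. by apply/divdiff_invM/divdiff_far_fix; rewrite eqxx. Qed.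

End Far.

Lemma divdiff_far i j (lt_i : (i.+1 < n)%N) (lt_j : (j.+1 < n)%N) :
  (i.+1 < j)%N || (j.+1 < i)%N -> forall p,
  divdiff k lt_i (divdiff k lt_j p) = divdiff k lt_j (divdiff k lt_i p).
Proof.
move=> far p; apply/esym/divdiff_uniq.
have far' : (j.+1 < i)%N || (i.+1 < j)%N by rewrite orbC.
have sd q : divdiff k lt_j (swap lt_i q) = swap lt_i (divdiff k lt_j q).
  apply/esym/divdiff_uniq; rewrite swap_far // -swapB -[in RHS](divdiffE lt_j).
  rewrite swapM swapB !swapX !tpermD // -val_eqE /=; lia.
have -> : ('X_(lo lt_i) - 'X_(hi lt_i)) * divdiff k lt_j (divdiff k lt_i p) =
    divdiff k lt_j (('X_(lo lt_i) - 'X_(hi lt_i)) * divdiff k lt_i p).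
  apply/esym/divdiff_invM.
  by rewrite EndB !(divdiff_far_fix lt_j lt_i far') ?eqxx ?orbT // subrr.
by rewrite divdiffE EndB sd.
Qed.

Lemma ddiff_far i j : (i.+1 < j)%N || (j.+1 < i)%N -> ddiff i * ddiffm j =
  ddiffm j * ddiff i.
Proof.
move=> far; have [/ddiff_out ->|lt_i] := leqP n i.+1; first by rewrite mul0r mulr0.
have [/ddiffm_out ->|lt_j] := leqP n j.+1; first by rewrite mul0r mulr0.
rewrite ddiffE ddiffmE; apply/polyEndP => p; rewrite !mulEndE !divdiff_minus_raise.
rewrite (divdiff_far_lo lt_i lt_j far) EndB (divdiff_far_lo lt_i lt_j far).
by rewrite (divdiff_far lt_i lt_j far).
Qed.

Lemma ddiff_up i : (i.+2 < n)%N ->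
  ddiff i * ddiffm i.+1 = - 1 + ddiffm i * ddiff i + ddiffm i.+1 * ddiff i.+1 +
    ddiffm i * ddiff i.+1.
Proof.
move=> lt_j; have lt_i := ltnW lt_j; rewrite !ddiffE !ddiffmE; apply/polyEndP => p.
by rewrite !addEndE oppEndE oneEndE !mulEndE straighten_up.
Qed.

Lemma ddiff_down i : (i.+2 < n)%N ->
  ddiff i.+1 * ddiffm i = ddiffm i * ddiff i.+1
    + ((ddiffm i * ddiffm i.+1 - ddiffm i.+1 * ddiffm i) * (ddiff i *
      ddiff i.+1 - ddiff i.+1 * ddiff i)
       + (ddiffm i * ddiffm i.+1 * ddiffm i * (ddiff i * ddiff i.+1 * ddiff i)) *+ 2).
Proof.
move=> lt_j; have lt_i := ltnW lt_j; rewrite !ddiffE !ddiffmE; apply/polyEndP => p.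
by rewrite !mulEndE straighten_down -addrA.
Qed.
End TotalOperators.

(** * Idempotents of the 0-Hecke algebra *)

Section ZeroHecke.
Variables (E : pzRingType) (n : nat) (z : nat -> E).

Record zero_hecke : Prop := ZeroHecke {
  zh_idem : forall i, (i.+1 < n)%N -> z i * z i = z i;
  zh_far : forall i j, (i.+1 < j < n)%N -> z i * z j = z j * z i;
  zh_braid : forall i, (i.+2 < n)%N -> z i * z i.+1 * z i = z i.+1 * z i * z i.+1
}.

(** A reduced word of the longest permutation of [m] letters: the cycle
s_0 ... s_(m-2) followed by a longest word on one letter less. *)
Fixpoint longest_word m : seq nat :=
  if m is m'.+1 then iota 0 m' ++ longest_word m' else [::].

Hypothesis zh : zero_hecke.

Lemma far_prod i (s : seq nat) :
  (i < n)%N -> all (fun j => (j < n)%N && ((i.+1 < j)%N || (j.+1 < i)%N)) s ->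
  z i * (\prod_(j <- s) z j) = (\prod_(j <- s) z j) * z i.
Proof.
move=> lt_in; elim: s => [|j s IH] /=; first by rewrite big_nil mulr1 mul1r.
move=> /andP[/andP[jn far] /IH{}IH]; rewrite big_cons -mulrA -IH !mulrA.
congr (_ * _); case/orP: far => far; first by rewrite zh_far ?far.
by rewrite [RHS]zh_far ?far.
Qed.

(** The Coxeter element conjugates each generator into its neighbour: all
factors commute past except two, where the braid relation is used. *)
Lemma coxeter_shift m i : (m < n)%N -> (i.+1 < m)%N ->
  z i.+1 * \prod_(j <- iota 0 m) z j = (\prod_(j <- iota 0 m) z j) * z i.
Proof.
move=> lt_mn lt_im.
have -> : iota 0 m = iota 0 i ++ [:: i; i.+1] ++ iota i.+2 (m - i.+2).
  by rewrite -[m in LHS](subnKC lt_im) -addn2 -addnA iotaD iotaD add0n addn2.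
rewrite !big_cat /= !big_cons big_nil mulr1.
set A := \prod_(j <- iota 0 i) z j; set B := \prod_(j <- iota _ _) z j.
have cA : z i.+1 * A = A * z i.+1.
  by apply: far_prod; [|apply/allP => j; rewrite mem_iota]; lia.
have cB : z i * B = B * z i.
  by apply: far_prod; [|apply/allP => j; rewrite mem_iota]; lia.
rewrite -!mulrA -cB !mulrA cA; congr (_ * _).
rewrite -!mulrA; congr (_ * _); rewrite !mulrA -zh_braid //; lia.
Qed.

(** In 0-Hecke algebras the longest element absorbs every generator. The
generators of positive index are first moved across the Coxeter element. *)
Lemma longest_absorb m i : (m <= n)%N -> (i.+1 < m)%N ->
  z i * \prod_(j <- longest_word m) z j = \prod_(j <- longest_word m) z j.
Proof.
elim: m i => // m IH i lt_mn lt_im; rewrite /= big_cat /= mulrA.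
case: i lt_im => [|i] lt_im.
  case: m {IH} lt_mn lt_im => // m lt_mn _.
  by rewrite /= big_cons !mulrA zh_idem //; lia.
by rewrite coxeter_shift // -mulrA IH // ltnW.
Qed.
End ZeroHecke.

(** The relations are symmetric under reversing products, so absorption on the
right follows from absorption on the left. *)
Lemma zero_hecke_rev (E : pzRingType) n (z : nat -> E) :
  zero_hecke n z -> zero_hecke n (z : nat -> E^c).
Proof.
move=> zh; split=> [i lt_i|i j ij|i lt_i]; first exact: (zh_idem zh).
  exact/esym/(zh_far zh).
by have h := zh_braid zh lt_i; rewrite -!mulrA in h; apply: h.
Qed.

Lemma longest_absorb_rev (E : pzRingType) n (z : nat -> E) m i :
  zero_hecke n z -> (m <= n)%N -> (i.+1 < m)%N ->
  (\prod_(j <- rev (longest_word m)) z j) * z i =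
  \prod_(j <- rev (longest_word m)) z j.
Proof.
move=> /zero_hecke_rev zh le_mn lt_im.
by have := longest_absorb zh le_mn lt_im; rewrite rev_prodr.
Qed.

Lemma longest_word_lt m j : j \in longest_word m -> (j.+1 < m)%N.
Proof.
elim: m => // m IH; rewrite mem_cat mem_iota => /orP[|/IH]; lia.
Qed.

(** Every word in a straightening identity has as many raising as lowering
factors, so the powers of [nu] cancel up to a factor that does not depend on the
position [i]. *)
Lemma ladder_scale (k : fieldType) (E : algType k) n (D Dm : nat -> E) nu :
  nu != 0 -> ladder 1 n D Dm ->
  ladder nu n (fun i => nu ^+ i *: D i) (fun i => nu ^- i *: Dm i).
Proof.
move=> nu0 L.
have mulZZ c d (a b : E) : (c *: a) * (d *: b) = (c * d) *: (a * b).
  by rewrite -scalerAl -scalerAr scalerA.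
have nui i : nu ^+ i != 0 by rewrite expf_neq0.
split=> [i ni|i ni|i j ij|i ni|i ni].
- by have [-> ->] := ladder_out L ni; rewrite !scaler0.
- by rewrite !mulZZ mulfV // mulVf // !scale1r (ladder_diag L).
- by rewrite !mulZZ (ladder_far L) // mulrC.
- rewrite !mulZZ !mulVf // !scale1r (ladder_up L) // invr1 !scale1r.
  have -> : nu ^+ i * nu ^- i.+1 = nu^-1
    by rewrite exprS; field; rewrite nu0 nui.
  have -> : nu ^- i * nu ^+ i.+1 = nu by rewrite exprS; field; rewrite nui.
  by rewrite scalerA mulVf // scale1r.
rewrite !mulZZ (mulrC (nu ^- i.+1)) (mulrC (nu ^+ i.+1) (nu ^+ i)).
rewrite -!scalerBr !mulZZ (ladder_down L) // scale1r.
have -> : nu ^- i * nu ^- i.+1 * (nu ^+ i * nu ^+ i.+1) = 1.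
  by rewrite !exprS; field; rewrite nu0 nui.
have -> : nu ^- i * nu ^- i.+1 * nu ^- i * (nu ^+ i * nu ^+ i.+1 * nu ^+ i) = 1.
  by rewrite !exprS; field; rewrite nu0 nui.
have -> : nu ^+ i.+1 * nu ^- i = nu by rewrite exprS; field; rewrite nui.
have -> : nu ^- i * nu ^+ i.+1 = nu by rewrite exprS; field; rewrite nui.
by rewrite !scale1r scalerDr.
Qed.

Section IsobaricDifferences.
Variables (k : fieldType) (n : nat).
Local Notation P := {mpoly k[n]}.
Implicit Types p q : P.

Definition symm m p := forall i, (i.+1 < m)%N -> ddiff k n i p = 0.

Lemma ddiff_1 i : ddiff k n i 1 = 0.
Proof.
by have [/ddiff_out ->|lt_i] := leqP n i.+1; rewrite ?ddiffE ?divdiff_1.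
Qed.

Lemma symm1 m : symm m 1. Proof. by move=> i _; apply: ddiff_1. Qed.

(** The isobaric divided difference, equal to p |-> p - x_i d_i p; it projects
onto the polynomials invariant under the i-th transposition. *)
Definition isobaric i := ddiff k n i * ddiffm k n i.

Lemma ddiff_dd i : ddiff k n i * ddiff k n i = 0.
Proof.
have [/ddiff_out ->|lt_i] := leqP n i.+1; first by rewrite mulr0.
by rewrite ddiffE; apply/polyEndP => p; rewrite mulEndE divdiff_divdiff.
Qed.

Lemma ddiffm_ddiffm i : ddiffm k n i * ddiffm k n i = 0.
Proof.
have [/ddiffm_out ->|lt_i] := leqP n i.+1; first by rewrite mulr0.
rewrite ddiffmE; apply/polyEndP => p; rewrite mulEndE !divdiff_minus_raise.
rewrite divdiff_loM EndB divdiff_loM divdiff_divdiff mulr0 add0r subrr mulr0 add0r.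
by rewrite subrr mulr0.
Qed.

Lemma isobaric_zero_hecke : zero_hecke n isobaric.
Proof.
split=> [i lt_i|i j ij|i lt_j].
- have e : ddiffm k n i * ddiff k n i = 1 - isobaric i by
    rewrite /isobaric ddiff_diag // opprB addrC subrK.
  rewrite {1 2}/isobaric mulrA -(mulrA (ddiff k n i)) e mulrBr mulr1 /isobaric mulrA ddiff_dd.
  by rewrite mul0r subr0.
- have lt_i : (i.+1 < n)%N by lia.
  have [/ddiff_out e|lt_j] := leqP n j.+1; first by rewrite /isobaric e !mul0r mulr0.
  have far : (i.+1 < j)%N || (j.+1 < i)%N by lia.
  have far' : (j.+1 < i)%N || (i.+1 < j)%N by rewrite orbC.
  have zE l (ltl : (l.+1 < n)%N) p :
      isobaric l p = p - 'X_(lo ltl) * divdiff k ltl p.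
    rewrite /isobaric ddiff_diag // addEndE oppEndE oneEndE mulEndE ddiffE ddiffmE.
    by rewrite divdiff_minus_raise divdiff_divdiff mulr0 subr0.
  apply/polyEndP => p; rewrite (mulEndE (isobaric i)) (mulEndE (isobaric j)).
  rewrite !(zE i lt_i) !(zE j lt_j) !EndB.
  rewrite (divdiff_far_lo lt_i lt_j far) (divdiff_far_lo lt_j lt_i far').
  rewrite (divdiff_far lt_i lt_j far).
  move: (divdiff k lt_j (divdiff k lt_i p)) (divdiff k lt_i p).
  by move: (divdiff k lt_j p) 'X_(lo lt_i) 'X_(lo lt_j) => b x y ba a; ring.
rewrite /isobaric.
have lt_i := ltnW lt_j; rewrite !ddiffE !ddiffmE; apply/polyEndP => p.
by rewrite !mulEndE; apply: zero_hecke_braid.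
Qed.
End IsobaricDifferences.

Section PolynomialLadder.
Variables (k : fieldType) (n : nat) (nu : k).
Hypothesis nu_neq0 : nu != 0.
Local Notation P := {mpoly k[n]}.
Implicit Types p q : P.

(** The number [m] of strands on which the operators act may be smaller than
the number [n] of variables: this allows induction on [m] inside a fixed
polynomial ring. *)
Definition lowering m i : polyEnd k n :=
  nu ^+ i *: (if (i.+1 < m)%N then ddiff k n i else 0).
Definition raising m i : polyEnd k n :=
  nu ^- i *: (if (i.+1 < m)%N then ddiffm k n i else 0).

Lemma poly_ladder m : (m <= n)%N -> ladder nu m (lowering m) (raising m).
Proof.
move=> le_mn.
apply: (ladder_scale (D := fun i => if (i.+1 < m)%N then ddiff k n i else 0)
                     (Dm := fun i => if (i.+1 < m)%N then ddiffm k n i else 0)) => //.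
split=> [i|i lt_i|i j ij|i lt_i|i lt_i].
- by rewrite leqNgt => /negPf ->.
- by rewrite lt_i ddiff_diag //; lia.
- by case: ifP; case: ifP; rewrite ?(mul0r, mulr0) // => _ _; apply: ddiff_far.
- by rewrite lt_i (ltnW lt_i) ddiff_up ?invr1 ?scale1r //; lia.
by rewrite lt_i (ltnW lt_i) ddiff_down ?scale1r //; lia.
Qed.

(** Polynomials of degree [r] in the module generated by 1: a
substitute for the harmonic polynomials, of total dimension m!. *)
Definition harm m := level (raising m) (@polyEnd_fun k n) 1.

Lemma low_symm m p : (forall i, lowering m i p = 0) <-> symm m p.
Proof.
split=> [h i lt_i | h i].
  have /eqP := h i; rewrite /lowering lt_i scaleEndE scaler_eq0 expf_eq0.
  by rewrite (negPf nu_neq0) andbF => /eqP.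
rewrite /lowering scaleEndE; case: ifP => [/h ->|_]; first by rewrite scaler0.
by rewrite -[(0 : polyEnd k n) p]/(0 : P) scaler0.
Qed.

Lemma harm_lower m r i p : (m <= n)%N ->
  harm m r.+1 p -> harm m r (lowering m i p).
Proof.
move=> le_mn; apply: (@level_lower _ _ (lowering m)) => //.
- exact: EndP.
- by move=> j; rewrite (low_symm m 1).2 //; apply: symm1.
exact/ladder_balanced/poly_ladder.
Qed.

Lemma harm_lower0 m i p : (m <= n)%N -> harm m 0 p -> lowering m i p = 0.
Proof.
move=> le_mn; apply: (@level0_lower _ _ (lowering m) (raising m)) => //.
- exact: EndP.
- by move=> j; rewrite (low_symm m 1).2 //; apply: symm1.
exact/ladder_balanced/poly_ladder.
Qed.

Lemma harm0P m p : harm m 0 p <-> exists c, p = c *: 1.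
Proof.
split=> [|[c ->]]; last by apply: lspanZ; apply: lspan_in.
elim=> [|c u w <- _ [d ->]]; first by exists 0; rewrite scale0r.
by exists (c + d); rewrite scalerDl.
Qed.

Lemma harm_ddiffm m r i p : (i.+1 < m)%N -> harm m r p -> harm m r.+1 (ddiffm k n i p).
Proof.
move=> lt_i rp; have := level_raise (Dm := raising m) (act := @polyEnd_fun k n) i rp.
move/(lspanZ (nu ^+ i)); rewrite /raising lt_i scaleEndE scalerA mulfV ?scale1r //.
by rewrite expf_neq0.
Qed.

Lemma harm_ddiff m r i p : (m <= n)%N -> (i.+1 < m)%N ->
  harm m r.+1 p -> harm m r (ddiff k n i p).
Proof.
move=> le_mn lt_i /(harm_lower i le_mn).
have -> : ddiff k n i p = nu ^- i *: lowering m i p.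
  by rewrite /lowering lt_i scaleEndE scalerA mulVf ?scale1r ?expf_neq0.
rewrite /harm; case: r => [|r]; exact: lspanZ.
Qed.

Lemma harm_ddiff0 m i p : harm m 0 p -> ddiff k n i p = 0.
Proof. by move=> /harm0P[c ->]; rewrite EndZ ddiff_1 scaler0. Qed.

End PolynomialLadder.

(** * The polynomials generated from 1 *)

Section Harmonics.
Variables (k : fieldType) (n : nat) (nu : k).
Hypothesis nu_neq0 : nu != 0.
Local Notation P := {mpoly k[n]}.
Local Notation ddiff := (ddiff k n).
Local Notation ddiffm := (ddiffm k n).
Local Notation isobaric := (isobaric k n).
Local Notation symm := (@symm k n).
Local Notation harm := (@harm k n nu).
Implicit Types p q h : P.

Definition symmetrizer m := \prod_(j <- longest_word m) isobaric j.

Lemma isobaricE i p : (i.+1 < n)%N -> isobaric i p = p - ddiffm i (ddiff i p).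
Proof. by move=> lt_i; rewrite /isobaric ddiff_diag. Qed.

Lemma symmetrizer_symm m p : (m <= n)%N -> symm m (symmetrizer m p).
Proof.
move=> le_mn i lt_i; rewrite /symmetrizer.
rewrite -(longest_absorb (isobaric_zero_hecke k n) le_mn lt_i) -mulEndE /isobaric !mulrA.
by rewrite ddiff_dd !mul0r.
Qed.

Lemma prod_isobaric_symm m s p : (m <= n)%N -> {in s, forall j, j.+1 < m}%N ->
  symm m p -> (\prod_(j <- s) isobaric j) p = p.
Proof.
move=> le_mn s_lt sp; elim: s s_lt => [|j s IH] s_lt; first by rewrite big_nil.
have lt_j : (j.+1 < m)%N by apply: s_lt; rewrite mem_head.
rewrite big_cons mulEndE IH; last by move=> l ls; apply: s_lt; rewrite mem_behead.
by rewrite isobaricE ?sp ?End0 ?subr0 //; lia.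
Qed.

Definition rev_symmetrizer m := \prod_(j <- rev (longest_word m)) isobaric j.

Lemma rev_symmetrizer_ddiffm m i : (m <= n)%N -> (i.+1 < m)%N ->
  rev_symmetrizer m * ddiffm i = 0.
Proof.
move=> le_mn lt_i; rewrite /rev_symmetrizer.
rewrite -(longest_absorb_rev (isobaric_zero_hecke k n) le_mn lt_i) /isobaric -!mulrA.
by rewrite ddiffm_ddiffm !mulr0.
Qed.

Lemma rev_symmetrizer_symm m p : (m <= n)%N -> symm m p ->
  rev_symmetrizer m p = p.
Proof.
move=> le_mn; apply: prod_isobaric_symm => // j; rewrite mem_rev.
exact: longest_word_lt.
Qed.

Lemma rev_symmetrizer_harm m r p : (m <= n)%N -> harm m r.+1 p ->
  rev_symmetrizer m p = 0.
Proof.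
move=> le_mn; elim=> [|c u w [i [w' [_ ->]]] _ IH]; first by rewrite End0.
rewrite EndP IH addr0 /raising scaleEndE EndZ.
case: ifP => lt_i; last by rewrite [X in rev_symmetrizer m X]/= End0 !scaler0.
by rewrite -mulEndE rev_symmetrizer_ddiffm // [X in _ *: (_ *: X)]/= !scaler0.
Qed.

(** The reversed symmetrizer fixes symmetric polynomials and kills all raised
ones, so a polynomial with both properties is 0. *)
Lemma harm_symm0 m r p : (m <= n)%N -> harm m r.+1 p -> symm m p -> p = 0.
Proof.
by move=> le_mn hp sp; rewrite -(rev_symmetrizer_symm le_mn sp)
  (rev_symmetrizer_harm le_mn hp).
Qed.

Lemma op_degree_homog d (a : polyEnd k n) e f p :
  op_degree d a -> p \is e.-homog -> e%:Z *+ 2 + d = f%:Z *+ 2 ->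
  a p \is f.-homog.
Proof.
move=> ad pe ef; apply/dhomogP => u /(ad e p pe) /=; lia.
Qed.

Lemma ddiff_homog i e p : p \is e.+1.-homog -> ddiff i p \is e.-homog.
Proof.
have [/ddiff_out ->|lt_i] := leqP n i.+1; first by rewrite dhomog0.
by rewrite ddiffE => pe; apply: op_degree_homog (@divdiff_degree k n i lt_i) pe _; lia.
Qed.

Lemma ddiff_homog0 i p : p \is 0.-homog -> ddiff i p = 0.
Proof.
have [/ddiff_out ->|lt_i] := leqP n i.+1; first by [].
rewrite ddiffE => p0; apply/eqP; rewrite -msupp_eq0; case E: (msupp _) => [|u s] //.
by have := @divdiff_degree k n i lt_i 0 p p0 u; rewrite E mem_head => /(_ isT); lia.
Qed.

Lemma ddiffm_homog i e p : p \is e.-homog -> ddiffm i p \is e.+1.-homog.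
Proof.
have [/ddiffm_out ->|lt_i] := leqP n i.+1; first by rewrite dhomog0.
by rewrite ddiffmE => pe;
  apply: op_degree_homog (@divdiff_minus_degree k n i lt_i) pe _; lia.
Qed.

Lemma harm_homog m r p : harm m r p -> p \is r.-homog.
Proof.
elim: r p => [p /harm0P[c ->]|r IH p]; first exact/dhomogZ/dhomog1.
elim=> [|c u w [i [w' [/IH w'r ->]]] _ wr]; first exact: dhomog0.
apply: dhomogD => //; apply: dhomogZ; rewrite /raising scaleEndE; apply: dhomogZ.
by case: ifP => _; [apply: ddiffm_homog | apply: dhomog0].
Qed.

Lemma symm_invM q p i : ddiff i q = 0 -> ddiff i (q * p) = q * ddiff i p.
Proof.
have [/ddiff_out -> _|lt_i] := leqP n i.+1.
  by rewrite -[RHS]/(q * 0) mulr0.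
by rewrite ddiffE; apply: divdiff_invM.
Qed.

Lemma ddiffm_raise i (lt_i : (i.+1 < n)%N) p :
  ddiffm i p = 'X_(lo lt_i) * (p - 'X_(lo lt_i) * ddiff i p).
Proof. by rewrite ddiffmE ddiffE divdiff_minus_raise. Qed.

Lemma symm_invM_ddiffm q p i : ddiff i q = 0 -> ddiffm i (q * p) = q * ddiffm i p.
Proof.
move=> dq; have [/ddiffm_out ->|lt_i] := leqP n i.+1.
  by rewrite -[RHS]/(q * 0) mulr0.
rewrite !ddiffm_raise symm_invM //.
by move: (ddiff i p) 'X_(lo lt_i) => d x; ring.
Qed.

Lemma inNC_symm (a : polyEnd k n) q p : inNC a -> symm n q -> a (q * p) = q * a p.
Proof.
move=> aNC sq; elim: aNC p => [i lt_i|i lt_i||c b b' _ IH _ IH'|b b' _ IH _ IH'] p.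
- by rewrite -ddiffE symm_invM // sq.
- by rewrite -ddiffmE symm_invM_ddiffm // sq.
- by [].
- by rewrite !addEndE !scaleEndE IH IH' mulrDr scalerAr.
by rewrite !mulEndE IH' IH.
Qed.

Definition symm_harm e := lspan (fun p => exists f r q h,
  [/\ symm n q, q \is f.-homog, harm n r h, (f + r = e)%N & p = q * h]).

Lemma symm_harm_ddiffm i e p : (i.+1 < n)%N -> symm_harm e p ->
  symm_harm e.+1 (ddiffm i p).
Proof.
move=> lt_i; apply: lspan_map; first exact: EndP.
move=> _ [f [r [q [h [sq qf hr <- ->]]]]]; apply: lspan_in.
exists f, r.+1, q, (ddiffm i h); split => //; first exact: harm_ddiffm.
  by rewrite addnS.
by rewrite symm_invM_ddiffm // sq.
Qed.

Lemma symm_harm_isobaric i e p : (i.+1 < n)%N -> symm_harm e p ->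
  symm_harm e (isobaric i p).
Proof.
move=> lt_i; apply: lspan_map; first exact: EndP.
move=> _ [f [r [q [h [sq qf hr <- ->]]]]]; apply: lspan_in.
exists f, r, q, (isobaric i h); split => //.
  by rewrite /isobaric mulEndE; apply: harm_ddiff => //; apply: harm_ddiffm.
by rewrite !mulEndE symm_invM_ddiffm ?sq // symm_invM ?sq.
Qed.

(** By induction on the degree. The symmetrizer Z satisfies that Z p is
symmetric, while p - Z p telescopes into elements built from raised divided
differences of [p], which have smaller degree before raising. *)
Theorem homog_symm_harm e p : p \is e.-homog -> symm_harm e p.
Proof.
elim: e p => [|e IH] p pe.
  rewrite -[p]mulr1; apply: lspan_in; exists 0%N, 0%N, p, 1; split=> //.
    by move=> i _; apply: ddiff_homog0.
  by apply/harm0P; exists 1; rewrite scale1r.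
have step i q : (i.+1 < n)%N -> q \is e.+1.-homog -> symm_harm e.+1 (q - isobaric i q).
  move=> lt_i qe; rewrite isobaricE // opprB addrC subrK.
  by apply: symm_harm_ddiffm => //; apply/IH/ddiff_homog.
have homog_zz i q : q \is e.+1.-homog -> isobaric i q \is e.+1.-homog.
  by move=> qe; rewrite /isobaric mulEndE; apply/ddiff_homog/ddiffm_homog.
pose Z := symmetrizer n.
have : {in longest_word n, forall j, j.+1 < n}%N by move=> j; apply: longest_word_lt.
have -> : p = Z p + (p - Z p) by rewrite addrC subrK.
have Zp : Z p \is e.+1.-homog.
  rewrite /Z /symmetrizer; elim: (longest_word n) => [|j s IHs].
    by rewrite big_nil.
  by rewrite big_cons mulEndE; apply: homog_zz.
move=> words; apply: lspanD.
  apply: lspan_in; exists e.+1, 0%N, (Z p), 1.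
  split=> //; [exact: symmetrizer_symm| |by rewrite addn0|by rewrite mulr1].
  by apply/harm0P; exists 1; rewrite scale1r.
rewrite /Z /symmetrizer; elim: (longest_word n) words => [|j s IHs] words.
  by rewrite big_nil subrr; apply: lspan0.
have lt_j : (j.+1 < n)%N by apply: words; rewrite mem_head.
rewrite big_cons mulEndE; set q := (\prod_(l <- s) isobaric l : polyEnd k n) p.
(* p - z_j q = d_j^- d_j p + z_j (p - q) *)
have -> : p - isobaric j q = (p - isobaric j p) + isobaric j (p - q) by
  rewrite EndB addrA subrK.
apply: lspanD; first exact: step.
apply: symm_harm_isobaric => //; apply: IHs => l ls; apply: words.
by rewrite in_cons ls orbT.
Qed.

(** Operators of the algebra are linear over symmetric polynomials, so they are
determined by their values on the module generated by 1. *)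
Lemma inNC_harm_eq (a b : polyEnd k n) : inNC a -> inNC b ->
  (forall r h, harm n r h -> a h = b h) -> a = b.
Proof.
move=> aNC bNC ab; apply: polyEnd_eqX => u.
have /homog_symm_harm : 'X_[u] \is [in k[n], (mdeg u).-homog] by rewrite dhomogX.
elim=> [|c p w [f [r [q [h [sq _ hr _ ->]]]]] _ IH]; first by rewrite !End0.
by rewrite !EndP IH !inNC_symm // (ab r).
Qed.

Lemma inNC_harm_degree d (b : polyEnd k n) : inNC b ->
  (forall r h, harm n r h -> forall u, u \in msupp (b h) ->
    (mdeg u)%:Z *+ 2 = r%:Z *+ 2 + d) ->
  op_degree d b.
Proof.
move=> bNC bd e p /homog_symm_harm.
elim=> [|c w w' [f [r [q [h [sq qf hr <- ->]]]]] _ IH] u; first by rewrite End0 msupp0.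
rewrite EndP => /msuppD_le; rewrite mem_cat => /orP[|/IH //].
move=> /msuppZ_le; rewrite inNC_symm // =>
  /msuppM_le /allpairsP[[u1 u2]] /= [u1q u2b ->].
have := bd r h hr u2 u2b; have /dhomogP /(_ u1 u1q) /= := qf.
rewrite mdegD; lia.
Qed.

Definition xvar j : P := if insub j is Some i then 'X_i else 0.

(** The elementary symmetric polynomial of degree [j] in the first [m]
variables. *)
Fixpoint elem (m j : nat) : P :=
  if m is m'.+1 then elem m' j + xvar m' * (if j is j'.+1 then elem m' j' else 0)
  else (j == 0%N)%:R.

Lemma xx_lo i (lt_i : (i.+1 < n)%N) : xvar i = 'X_(lo lt_i).
Proof.
rewrite /xvar; case: insubP => [l _ li|]; last by rewrite (ltnW lt_i).
by congr 'X_ _; apply: val_inj.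
Qed.

Lemma xx_hi i (lt_i : (i.+1 < n)%N) : xvar i.+1 = 'X_(hi lt_i).
Proof.
rewrite /xvar; case: insubP => [l _ li|]; last by rewrite lt_i.
by congr 'X_ _; apply: val_inj.
Qed.

Lemma ddiff_xx_lo i p : (i.+1 < n)%N -> ddiff i (xvar i * p) = xvar i.+1 *
  ddiff i p + p.
Proof. by move=> lt_i; rewrite (xx_lo lt_i) (xx_hi lt_i) ddiffE divdiff_loM. Qed.

Lemma ddiff_xx_hi i p : (i.+1 < n)%N -> ddiff i (xvar i.+1 * p) = xvar i *
  ddiff i p - p.
Proof. by move=> lt_i; rewrite (xx_lo lt_i) (xx_hi lt_i) ddiffE divdiff_hiM. Qed.

Lemma ddiff_xx i j p : (i.+1 < n)%N -> j != i -> j != i.+1 ->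
  ddiff i (xvar j * p) = xvar j * ddiff i p.
Proof.
move=> lt_i ji ji1; apply: symm_invM; rewrite /xvar; case: insubP => [l _ lj|_].
  by rewrite ddiffE divdiff_other // -val_eqE /= lj.
by rewrite End0.
Qed.

Lemma ddiff_elem i m j : (i.+1 < n)%N ->
  ddiff i (elem m j) = if (i.+1 == m) && (0 < j)%N then elem m.-1 j.-1 else 0.
Proof.
move=> lt_i; elim: m j => [|m IH] j /=.
  by rewrite -scaler_nat EndZ ddiff_1 scaler0.
case: j => [|j]; first by rewrite mulr0 addr0 IH !andbF.
rewrite andbT EndD IH eqSS /=.
have [e|ne_im] := eqVneq i m.
  by subst m; rewrite gtn_eqF ?leqnn //= ddiff_xx_lo // IH gtn_eqF //= mulr0 !add0r.
have [e|ne_im1] := eqVneq i.+1 m; last first.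
  rewrite ddiff_xx //; [|by rewrite eq_sym..].
  by rewrite IH (negPf ne_im1) mulr0 addr0.
subst m; rewrite ddiff_xx_hi // IH eqxx; case: j => [|j] /=.
  by rewrite !mulr0 addr0 sub0r subrr.
by rewrite addrA subrr.
Qed.

Lemma ddiffm_elem m j : (m.+1 < n)%N -> ddiffm m (elem m j) = xvar m * elem m j.
Proof.
move=> lt_m; rewrite (ddiffm_raise lt_m) ddiff_elem // gtn_eqF //= mulr0 subr0.
by rewrite -xx_lo.
Qed.

Lemma harm_mono m r p : harm m r p -> harm m.+1 r p.
Proof.
elim: r p => [|r IH] p //; elim=> [|c u w [i [w' [w'r ->]]] _ wr].
  exact: lspan0.
apply: lspan_lin => //; have [lt_i|] := ltnP i.+1 m.
  have -> : raising n nu m i w' = raising n nu m.+1 i w' by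
    rewrite /raising lt_i ltnS ltnW.
  exact/level_raise/IH.
rewrite /raising leqNgt => /negPf ->.
rewrite scaleEndE [X in _ *: X](_ : _ = 0) // scaler0; exact: lspan0.
Qed.

(** The factor of the last variable in the recursion for [elem] is a raising
operator, because the polynomial it multiplies does not contain the two
variables involved. *)
Lemma elem_harm m j : (m < n)%N -> harm m.+1 j (elem m j).
Proof.
elim: m j => [|m IH] j lt_m /=.
  case: j => [|j]; last exact: level0.
  by apply/harm0P; exists 1; rewrite scale1r.
rewrite -[elem m j]scale1r; apply: level_lin.
  exact/harm_mono/IH/ltnW.
case: j => [|j]; first by rewrite mulr0; apply: level0.
rewrite -ddiffm_elem //; apply: harm_ddiffm => //; exact/harm_mono/IH/ltnW.
Qed.

(** Operators on the first [m] strands are linear over polynomials symmetric in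
the first [m] variables, so they carry the previous lemma from 1 to [h]. *)
Lemma elem_mul_harm m j r h : (m < n)%N -> harm m r h ->
  harm m.+1 (j + r) (elem m j * h).
Proof.
move=> lt_m; have lin : linear ( *%R (elem m j)).
  by move=> c p q; rewrite mulrDr scalerAr.
elim: r h => [|r IH] h.
  by move=> /harm0P[c ->]; rewrite -scalerAr mulr1 addn0; apply/levelZ/elem_harm.
rewrite addnS; apply: lspan_map => // _ [i [w [/IH rw ->]]].
rewrite /raising scaleEndE -scalerAr; apply: lspanZ; case: ifP => lt_i; last first.
  by rewrite [X in _ * X](_ : _ = 0) // mulr0; apply: lspan0.
rewrite -symm_invM_ddiffm; first by apply: harm_ddiffm => //; apply: leqW.
by rewrite ddiff_elem ?ltn_eqF //; lia.
Qed.

Lemma elem_free m (c : nat -> k) : (m < n)%N ->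
  \sum_(j < m.+1) c j *: elem m j = 0 -> forall j, (j <= m)%N -> c j = 0.
Proof.
elim: m c => [|m IH] c lt_m.
  rewrite big_ord1 /= => /eqP; rewrite scaler_eq0 oner_eq0 orbF => /eqP c0 j.
  by rewrite leqn0 => /eqP ->.
move=> sum0; have cS j : (j <= m)%N -> c j.+1 = 0.
  apply: (IH (fun j => c j.+1)) => //; first exact: ltnW.
  have := congr1 (ddiff m) sum0; rewrite End0 End_sum.
  rewrite big_ord_recl => sum1; apply: etrans sum1;
    rewrite [ddiff m _]EndZ ddiff_elem // andbF scaler0 add0r.
  by apply: eq_bigr => i _; rewrite [RHS]EndZ ddiff_elem // eqxx.
case=> [_|j /cS //]; move: sum0; rewrite big_ord_recl big1 => [|i _].
  rewrite addr0 => /eqP; rewrite scaler_eq0.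
  have -> : elem m.+1 0 = 1.
    by elim: m.+1 => //= l ->; rewrite mulr0 addr0.
  by rewrite oner_eq0 orbF => /eqP.
by rewrite cS ?scale0r // -ltnS.
Qed.

(** The bound [R] on the degrees is the induction parameter for independence:
divided differences decrease it. *)
Definition harm_below m R := lspan (fun p => exists2 r, (r < R)%N & harm m r p).

Lemma harm_below_symm m R p : (m <= n)%N -> harm_below m R p -> symm m p ->
  exists c, p = c *: 1.
Proof.
move=> le_mn pR sp; rewrite -(rev_symmetrizer_symm le_mn sp).
elim: pR {sp} => [|c u w [r _ ur] _ [d IH]]; first by exists 0; rewrite End0 scale0r.
rewrite EndP IH; case: r ur => [/harm0P[e ->]|r ur].
  exists (c * e + d); rewrite EndZ rev_symmetrizer_symm ?scalerDl ?scalerA //.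
  exact: symm1.
by exists d; rewrite (rev_symmetrizer_harm le_mn ur) scaler0 add0r.
Qed.

Lemma harm_below_ddiff m R i p : (m <= n)%N -> (i.+1 < m)%N ->
  harm_below m R.+1 p -> harm_below m R (ddiff i p).
Proof.
move=> le_mn lt_i; apply: lspan_map; first exact: EndP.
move=> u [[|r] rR ur]; first by rewrite (harm_ddiff0 i ur); apply: lspan0.
by apply: lspan_in; exists r => //; apply: harm_ddiff ur.
Qed.

(** Divided differences on the first [m] strands act on the coefficients [g j]
of a linear relation alone. By induction they kill all [g j], which then are
symmetric, hence constants; and the [elem m j] are independent over constants
since they have different degrees. *)
Lemma elem_harm_free m R (g : nat -> P) : (m < n)%N ->
  (forall j, harm_below m R (g j)) ->
  \sum_(j < m.+1) elem m j * g j = 0 -> forall j, (j <= m)%N -> g j = 0.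
Proof.
move=> lt_m; elim: R g => [|R IH] g gR sum0.
  move=> j _; elim: (gR j) => // c u w [r]; by rewrite ltn0.
have dg i j : (i.+1 < m)%N -> (j <= m)%N -> ddiff i (g j) = 0.
  move=> lt_i; move: j; apply: (IH (fun j => ddiff i (g j))).
    by move=> j; apply: harm_below_ddiff => //; apply: ltnW.
  have := congr1 (ddiff i) sum0; rewrite End0 End_sum => sum1; apply: etrans sum1.
  apply: eq_bigr => j _; rewrite [RHS]symm_invM // ddiff_elem ?ltn_eqF //; lia.
have /choice[c gc] : forall j, exists c, (j <= m)%N -> g j = c *: 1.
  move=> j; have [le_jm|_] := leqP j m; last by exists 0.
  have [|c ->] := harm_below_symm (ltnW lt_m) (gR j); last by exists c.
  by move=> i lt_i; apply: dg.
move=> j le_jm; rewrite gc //; rewrite (@elem_free m c) ?scale0r //.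
apply: etrans sum0; apply: eq_bigr => i _.
have le_im : (i <= m)%N by rewrite -ltnS.
by rewrite gc // -scalerAr mulr1.
Qed.

Theorem harm_family m : (m <= n)%N ->
  exists (I : finType) (h : I -> P) (r : I -> nat),
    [/\ #|I| = m`!, forall i, harm m (r i) (h i)
      & forall c : I -> k, \sum_i c i *: h i = 0 -> forall i, c i = 0].
Proof.
elim: m => [_|m IH lt_m].
  exists unit, (fun=> 1), (fun=> 0%N); split=> [|_|c].
  - by rewrite card_unit.
  - by apply/harm0P; exists 1; rewrite scale1r.
  rewrite (big_pred1 tt) => [/eqP|[]//].
  by rewrite scaler_eq0 oner_eq0 orbF => /eqP c0 [].
have [I [h [r [cardI hr free]]]] := IH (ltnW lt_m).
exists (I * 'I_m.+1)%type, (fun x : I * 'I_m.+1 => elem m x.2 * h x.1),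
  (fun x : I * 'I_m.+1 => x.2 + r x.1)%N.
split=> [|x|c sum0 [i j]].
- by rewrite card_prod cardI card_ord factS mulnC.
- exact: elem_mul_harm.
pose g l := if insub l is Some l' then \sum_i c (i, l') *: h i else 0 : P.
have gE (l : 'I_m.+1) : g l = \sum_i c (i, l) *: h i by rewrite /g valK.
apply: (free (fun i => c (i, j))); rewrite -gE.
apply: (@elem_harm_free m (\max_i r i).+1) => //; last by rewrite -ltnS.
  move=> l; rewrite /g; case: insub => [l'|]; last exact: lspan0.
  apply: lspan_sum => s _; apply/lspanZ/lspan_in; exists (r s); last exact: hr.
  by rewrite ltnS leq_bigmax.
apply: etrans sum0.
transitivity (\sum_s \sum_(l < m.+1) c (s, l) *: (elem m l * h s)).
  rewrite exchange_big; apply: eq_bigr => l _; rewrite gE mulr_sumr.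
  by apply: eq_bigr => s _; rewrite scalerAr.
by rewrite pair_bigA; apply: eq_bigr => -[].
Qed.
End Harmonics.

(** * Graded vector spaces and their dimension *)

Section EvaluationAtOne.
Local Notation Zq := {fraction {poly int}}.

(** Evaluation at q = 1 of the Laurent polynomials inside the field of rational
functions, as a relation since it is not defined on the whole field. *)
Definition value_at_one (x : Zq) (m : int) : Prop :=
  exists N (p : {poly int}), qvar ^+ N * x = tofrac p /\ p.[1] = m.

Lemma qvar_neq0 : qvar != 0.
Proof. by rewrite /qvar tofrac_eq0 polyX_eq0. Qed.

Lemma qvarX N : qvar ^+ N = tofrac 'X^N.
Proof. by rewrite /qvar -rmorphXn. Qed.

Lemma value_at_one_uniq x m m' :
  value_at_one x m -> value_at_one x m' -> m = m'.
Proof.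
move=> [N [p [ep <-]]] [N' [p' [ep' <-]]].
have /eqP : tofrac ('X^N' * p) = tofrac ('X^N * p').
  by rewrite !rmorphM /= -!qvarX -ep -ep' mulrCA.
by rewrite tofrac_eq => /eqP /(congr1 (horner^~ 1)); rewrite !hornerE !expr1n !mul1r.
Qed.

Lemma value_at_oneD x y m m' :
  value_at_one x m -> value_at_one y m' -> value_at_one (x + y) (m + m').
Proof.
move=> [N [p [ep <-]]] [N' [p' [ep' <-]]].
exists (N + N')%N, ('X^N' * p + 'X^N * p'); split.
  by rewrite rmorphD !rmorphM /= -!qvarX -ep -ep' exprD; ring.
by rewrite !hornerE !expr1n !mul1r.
Qed.

Lemma value_at_oneM x y m m' :
  value_at_one x m -> value_at_one y m' -> value_at_one (x * y) (m * m').
Proof.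
move=> [N [p [ep <-]]] [N' [p' [ep' <-]]].
exists (N + N')%N, (p * p'); split; last by rewrite hornerM.
by rewrite rmorphM /= -ep -ep' exprD; ring.
Qed.

Lemma value_at_one_nat (c : nat) : value_at_one c%:R c%:R.
Proof.
by exists 0%N, c%:R; rewrite mul1r rmorph_nat -polyC_natr hornerC.
Qed.

Lemma value_at_one_exp (d : int) : value_at_one (qvar ^ d) 1.
Proof.
case: d => d; first by exists 0%N, 'X^d; rewrite mul1r -exprnP qvarX hornerXn expr1n.
exists d.+1, 1; rewrite NegzE -exprnN mulfV ?expf_neq0 ?qvar_neq0 //.
by rewrite rmorph1 hornerC.
Qed.

Lemma value_at_one_qint i : value_at_one (qint i) i%:R.
Proof.
exists i, ('X * \sum_(l < i) 'X^2 ^+ l); split; last first.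
  rewrite hornerM hornerX mul1r horner_sum (eq_bigr (fun=> 1)) => [|l _].
    by rewrite sumr_const card_ord.
  by rewrite -exprM hornerXn expr1n.
have q2 : qvar ^+ 2 - 1 != 0.
  rewrite qvarX -tofrac1 -tofracB tofrac_eq0.
  by rewrite -size_poly_eq0 size_XnsubC.
have q1 : qvar - qvar^-1 != 0.
  apply: contra q2 => /eqP e.
  have -> : qvar ^+ 2 - 1 = qvar * (qvar - qvar^-1) by rewrite mulrBr mulfV ?qvar_neq0.
  by rewrite e mulr0.
apply: (mulIf q1); rewrite /qint -mulrA mulfVK //.
rewrite rmorphM /= -/qvar mulrBr mulfV ?expf_neq0 ?qvar_neq0 //.
have -> : qvar * tofrac (\sum_(l < i) 'X^2 ^+ l) * (qvar - qvar^-1) =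
    (qvar ^+ 2 - 1) * \sum_(l < i) (qvar ^+ 2) ^+ l.
  have -> : tofrac (\sum_(l < i) 'X^2 ^+ l) = \sum_(l < i) (qvar ^+ 2) ^+ l.
    by rewrite rmorph_sum; apply: eq_bigr => l _; rewrite qvarX -rmorphXn.
  by rewrite mulrAC mulrBr mulfV ?qvar_neq0.
by rewrite -subrX1 -exprM mulnC muln2 -addnn exprD.
Qed.

Lemma value_at_one_qfact n : value_at_one (qfact n) (n`!)%:R.
Proof.
rewrite fact_prod natr_prod; apply: (big_ind2 value_at_one).
- by have := value_at_one_nat 1.
- by move=> *; apply: value_at_oneM.
by move=> i _; apply: value_at_one_qint.
Qed.
End EvaluationAtOne.

Section GradedVectorSpace.
Variables (k : fieldType) (W : gradedVect k).

Lemma directv_seq (I : eqType) (s : seq I) (F : I -> {vspace W}) :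
  directv (\sum_(i <- s) F i) = directv (\sum_(i < size s) F (tnth (in_tuple s) i)).
Proof. by rewrite !directvE /= !(big_tnth _ _ s). Qed.

Lemma dim_graded : \dim {:W} = (\sum_(d <- gsupp W) \dim (gpart W d))%N.
Proof.
by rewrite -(gpart_full W); have := gpart_direct W; rewrite directvE => /eqP.
Qed.

(** At q = 1 the graded dimension becomes the dimension, and the quantum
factorial the factorial. *)
Lemma dim_qfact n : gdim W = qfact n -> \dim {:W} = n`!.
Proof.
move=> gW; suff : (\dim {:W})%:R = (n`!)%:R :> int by rewrite !natz => -[].
rewrite dim_graded.
apply: (@value_at_one_uniq (gdim W)); last by rewrite gW; apply: value_at_one_qfact.
rewrite /gdim natr_sum; apply: (big_ind2 value_at_one).
- by have := value_at_one_nat 0.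
- by move=> *; apply: value_at_oneD.
move=> d _; rewrite -[_%:R in X in value_at_one _ X]mulr1.
by apply: value_at_oneM; [apply: value_at_one_nat | apply: value_at_one_exp].
Qed.

Lemma graded_indep (F : int -> W) : (forall d, F d \in gpart W d) ->
  \sum_(d <- gsupp W) F d = 0 -> forall d, F d = 0.
Proof.
move=> FW sum0 d; have [ds|/gsupp_out d0] := boolP (d \in gsupp W); last first.
  by apply/eqP; rewrite -memv0 -d0.
have := gpart_direct W; rewrite directv_seq => /directv_sum_independent indep.
have/tnthP[i ->] : d \in in_tuple (gsupp W) by [].
apply: (indep (fun i => F (tnth (in_tuple (gsupp W)) i))) => //.
by rewrite big_tnth in sum0; apply: sum0.
Qed.

Definition gproj (d : int) : 'End(W) :=
  if d \in gsupp W then sumv_pi_for (esym (gpart_full W)) d else 0.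

Lemma gproj_part d w : gproj d w \in gpart W d.
Proof.
by rewrite /gproj; case: ifP => _; [apply: memv_sum_pi | rewrite lfunE mem0v].
Qed.

Lemma gproj_sum w : w = \sum_(d <- gsupp W) gproj d w.
Proof.
have ww : w \in fullv by rewrite memvf.
rewrite -[LHS](@sumv_pi_uniq_sum _ _ _ _ _ _ _ (esym (gpart_full W))) //.
  by apply: eq_big_seq => d ds; rewrite /gproj ds.
by rewrite filter_predT gsupp_uniq.
Qed.

Lemma gprojE d e w : w \in gpart W e -> gproj d w = if d == e then w else 0.
Proof.
move=> we; apply/eqP; rewrite -subr_eq0; apply/eqP; move: d.
apply: graded_indep => [d|].
  by apply: memvB; [apply: gproj_part | case: eqP => [->|_] //; apply: mem0v].
rewrite sumrB -gproj_sum -big_mkcond; apply/eqP; rewrite subr_eq0; apply/eqP.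
have [es|/gsupp_out e0] := boolP (e \in gsupp W).
  by rewrite -big_filter (filter_pred1_uniq (gsupp_uniq W) es) big_seq1.
have -> : w = 0 by apply/eqP; rewrite -memv0 -e0.
by rewrite big1.
Qed.
End GradedVectorSpace.

(** * Local generators of a tensor system *)

Lemma lrmorphism_of (k : fieldType) (A B : algType k) (f : A -> B) :
  linear f -> f 1 = 1 -> {morph f : a b / a * b} ->
  exists g : {lrmorphism A -> B}, g =1 f.
Proof.
move=> f_lin f1 fM.
pose L := GRing.isLinear.Build k A B *:%R f f_lin.
pose M := GRing.isMonoidMorphism.Build A B f (conj f1 fM).
pose g : {lrmorphism A -> B} := HB.pack f L M.
by exists g.
Qed.

Section Strands.
Variables (k : fieldType) (C : tensorSystem k).
Local Notation A := (alg C).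

(** Elements of all the algebras together: here the tensor product is strictly
associative, without transport along equalities of numbers of
strands. *)
Definition strands := {n : nat & A n}.
Definition strand_elt n (a : A n) : strands := Tagged (fun n => alg C n) a.

Lemma strand_elt_inj n (a b : A n) : strand_elt a = strand_elt b -> a = b.
Proof. exact: eq_from_Tagged. Qed.

Lemma strand_elt_cast n m (e : n = m) (a : A n) : strand_elt (ecast i (A i) e a) =
  strand_elt a.
Proof. by case: m / e. Qed.

Lemma cast_linear n m (e : n = m) c (a b : A n) :
  ecast i (A i) e (c *: a + b) = c *: ecast i (A i) e a + ecast i (A i) e b.
Proof. by case: m / e. Qed.

Lemma castM n m (e : n = m) (a b : A n) :
  ecast i (A i) e (a * b) = ecast i (A i) e a * ecast i (A i) e b.
Proof. by case: m / e. Qed.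

Lemma cast1 n m (e : n = m) : ecast i (A i) e 1 = 1.
Proof. by case: m / e. Qed.

Lemma cast_deg d n m (e : n = m) (a : A n) :
  has_deg C d a -> has_deg C d (ecast i (A i) e a).
Proof. by case: m / e. Qed.

Definition beside (x y : strands) : strands :=
  strand_elt (tens C (projT2 x) (projT2 y)).
Definition idle n : strands := strand_elt (1 : A n).

Hypothesis C_min : graded_minimal_categorification C.

Lemma tens_hom n m : graded_tensor_hom C n m.
Proof. by case: C_min. Qed.

Lemma tens_linearr n m (a : A n) : linear (fun b : A m => tens C a b).
Proof. by have [[+ _] _ _ _] := tens_hom n m. Qed.

Lemma tens_linearl n m (b : A m) : linear (fun a : A n => tens C a b).
Proof. by have [[_ +] _ _ _] := tens_hom n m. Qed.

Lemma tens1 n m : tens C (1 : A n) (1 : A m) = 1.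
Proof. by have [] := tens_hom n m. Qed.

Lemma tensM n m (a a' : A n) (b b' : A m) :
  tens C (a * a') (b * b') = tens C a b * tens C a' b'.
Proof. by have [_ _ + _] := tens_hom n m; apply. Qed.

Lemma tens_deg n m d e (a : A n) (b : A m) :
  has_deg C d a -> has_deg C e b -> has_deg C (d + e) (tens C a b).
Proof. by have [_ _ _ +] := tens_hom n m; apply. Qed.

Lemma deg_1 n : has_deg C 0 (1 : A n).
Proof.
have [/(_ n)[W _ [phi [_ phi1 _ deg]]] _ _ _ _] := C_min.
by apply/deg => e; rewrite phi1 lim1g addr0.
Qed.

Lemma besideA x y z : beside (beside x y) z = beside x (beside y z).
Proof.
case: C_min => _ _ _ /(_ _ _ _ (projT2 x) (projT2 y) (projT2 z)) e _.
by rewrite /beside /= e strand_elt_cast.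
Qed.

Lemma idleD n m : beside (idle n) (idle m) = idle (n + m).
Proof. by rewrite /beside /= tens1. Qed.

(** The element [a] acting on the [j] strands after the first [i] ones, and the
identity on the others. *)
Definition place n i j (a : A j) : A n :=
  if @idP (i + j + (n - i - j) == n)%N is ReflectT e
  then ecast l (A l) (eqP e) (tens C (tens C (1 : A i) a) (1 : A (n - i - j)))
  else 0.

Lemma place_out n i j (a : A j) : (n < i + j)%N -> place n i a = 0.
Proof. by rewrite /place; case: {-}_ / idP => // e; have := eqP e; lia. Qed.

Lemma placeE n i j (a : A j) (le : (i + j <= n)%N) :
  exists e : (i + j + (n - i - j) = n)%N,
  place n i a = ecast l (A l) e (tens C (tens C (1 : A i) a) (1 : A (n - i - j))).
Proof.
rewrite /place; case: {-}_ / idP => [e|]; first by exists (eqP e).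
by case; apply/eqP; lia.
Qed.

Lemma strand_elt_place n i j (a : A j) : (i + j <= n)%N ->
  strand_elt (place n i a) = beside (beside (idle i) (strand_elt a)) (idle (n - i - j)).
Proof. by move=> le; have [e ->] := placeE a le; rewrite strand_elt_cast. Qed.

Lemma place_linear n i j : linear (@place n i j).
Proof.
move=> c a b; have [/(place_out _) out|le] := ltnP n (i + j).
  by rewrite !out scaler0 addr0.
rewrite /place; case: {-}_ / idP => [e|]; last by rewrite scaler0 addr0.
by rewrite tens_linearr tens_linearl cast_linear.
Qed.

Lemma placeM n i j (a b : A j) : place n i (a * b) = place n i a * place n i b.
Proof.
rewrite /place; case: {-}_ / idP => [e|]; last by rewrite mulr0.
by rewrite -castM -!tensM !mulr1.
Qed.

Lemma place1 n i j : (i + j <= n)%N -> place n i (1 : A j) = 1.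
Proof. by move=> le; have [e ->] := placeE 1 le; rewrite !tens1 cast1. Qed.

Lemma place_deg n i j d (a : A j) : (i + j <= n)%N -> has_deg C d a ->
  has_deg C d (place n i a).
Proof.
move=> le ad; have [e ->] := placeE a le; apply: cast_deg; rewrite -[d]addr0.
apply: tens_deg (deg_1 _); rewrite -[d]add0r; exact: tens_deg (deg_1 _) ad.
Qed.

Lemma place_tensl n i j s (a : A j) : (i + (j + s) <= n)%N ->
  place n i (tens C a (1 : A s)) = place n i a.
Proof.
move=> le; apply: strand_elt_inj; rewrite !strand_elt_place; [|lia..].
rewrite -[strand_elt (tens C a 1)]/(beside (strand_elt a) (idle s)) -besideA [LHS]besideA idleD.
by congr (beside _ (idle _)); lia.
Qed.

Lemma place_tensr n i j s (a : A j) : (i + (s + j) <= n)%N ->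
  place n i (tens C (1 : A s) a) = place n (i + s) a.
Proof.
move=> le; apply: strand_elt_inj; rewrite !strand_elt_place; [|lia..].
rewrite -[strand_elt (tens C 1 a)]/(beside (idle s) (strand_elt a)) -besideA idleD.
by congr (beside _ (idle _)); lia.
Qed.

Lemma tensl_place n m i j (a : A j) : (i + j <= n)%N ->
  tens C (place n i a) (1 : A m) = place (n + m) i a.
Proof.
move=> le; apply: strand_elt_inj; rewrite strand_elt_place; last by lia.
rewrite -[LHS]/(beside (strand_elt (place n i a)) (idle m)) strand_elt_place // besideA idleD.
by congr (beside _ (idle _)); lia.
Qed.

Lemma tensr_place n m i j (a : A j) : (i + j <= m)%N ->
  tens C (1 : A n) (place m i a) = place (n + m) (n + i) a.
Proof.
move=> le; apply: strand_elt_inj; rewrite strand_elt_place; last by lia.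
rewrite -[LHS]/(beside (idle n) (strand_elt (place m i a))) strand_elt_place // -!besideA idleD.
by congr (beside _ (idle _)); lia.
Qed.

(** Both elements live on complementary groups of strands, so both products are
the tensor product of the two. *)
Lemma place_far n i j l s (a : A i) (b : A j) : (l + i <= s)%N ->
  place n l a * place n s b = place n s b * place n l a.
Proof.
move=> le; have [/(place_out b) ->|le'] := ltnP n (s + j).
  by rewrite mul0r mulr0.
have e : (s + (n - s) = n)%N by lia.
have -> : place n l a = ecast x (A x) e (tens C (place s l a) (1 : A (n - s))).
  by apply: strand_elt_inj; rewrite strand_elt_cast tensl_place // e.
have -> : place n s b = ecast x (A x) e (tens C (1 : A s) (place (n - s) 0 b)).
  by apply: strand_elt_inj; rewrite strand_elt_cast tensr_place ?addn0 ?e //; lia.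
by rewrite -!castM -!tensM !mulr1 !mul1r.
Qed.

Variables (nu : k) (d dm : A 2).
Hypothesis nu_neq0 : nu != 0.
Hypothesis d_dm : d * dm + dm * d = 1.
Variable phi : {lrmorphism A 3 -> NC k 3}.
Hypothesis phi_inj : injective phi.
Hypothesis phi_d1 : phi (tens C d (1 : A 1)) = NCd k (isT : (1 < 3)%N).
Hypothesis phi_d2 : phi (tens C (1 : A 1) d) = nu *: NCd k (isT : (2 < 3)%N).
Hypothesis phi_dm1 : phi (tens C dm (1 : A 1)) = NCdm k (isT : (1 < 3)%N).
Hypothesis phi_dm2 : phi (tens C (1 : A 1) dm) = nu^-1 *: NCdm k (isT : (2 < 3)%N).

Definition cross n i := place n i d.
Definition cross_dual n i := place n i dm.

Lemma place_morphism n i j : (i + j <= n)%N ->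
  exists f : {lrmorphism A j -> A n}, f =1 @place n i j.
Proof.
move=> le; apply: lrmorphism_of; [exact: place_linear|exact: place1|exact: placeM].
Qed.

Lemma phi_low : val (phi (tens C d (1 : A 1))) = lowering 3 nu 3 0 /\
  val (phi (tens C (1 : A 1) d)) = lowering 3 nu 3 1.
Proof.
rewrite phi_d1 phi_d2 /lowering expr0 scale1r.
by rewrite (ddiffE k (isT : (2 < 3)%N)) (ddiffE k (isT : (1 < 3)%N)).
Qed.

Lemma phi_up : val (phi (tens C dm (1 : A 1))) = raising 3 nu 3 0 /\
  val (phi (tens C (1 : A 1) dm)) = raising 3 nu 3 1.
Proof.
rewrite phi_dm1 phi_dm2 /raising expr0 invr1 scale1r.
by rewrite (ddiffmE k (isT : (2 < 3)%N)) (ddiffmE k (isT : (1 < 3)%N)).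
Qed.

(** Relations involving two adjacent indices are images of relations in the
three-strand algebra, which is identified with the standard one by [phi]; those
involving one index come from two strands. *)
Lemma cross_ladder n : ladder nu n (cross n) (cross_dual n).
Proof.
have [l1 l2] := phi_low; have [u1 u2] := phi_up.
have L3 := poly_ladder nu_neq0 (leqnn 3).
have split3 i : (i.+2 < n)%N -> exists f : {lrmorphism A 3 -> A n},
    [/\ f (tens C d (1 : A 1)) = cross n i, f (tens C (1 : A 1) d) = cross n i.+1,
        f (tens C dm (1 : A 1)) = cross_dual n i
      & f (tens C (1 : A 1) dm) = cross_dual n i.+1].
  move=> lt_i; have [|f fE] := @place_morphism n i 3; first by lia.
  exists f; rewrite !fE /cross /cross_dual -(addn1 i); split.
  - by apply: (@place_tensl n i 2 1); lia.
  - by apply: (@place_tensr n i 2 1); lia.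
  - by apply: (@place_tensl n i 2 1); lia.
  - by apply: (@place_tensr n i 2 1); lia.
split=> [i ni|i ni|i j ij|i /split3[f [<- <- <- <-]]|i /split3[f [<- <- <- <-]]].
- by rewrite /cross /cross_dual !place_out //; lia.
- have [|f fE] := @place_morphism n i 2; first by lia.
  by rewrite /cross /cross_dual -!fE -!rmorphM -(rmorph1 f) -rmorphB -d_dm addrK.
- by case/orP: ij => ij; [|apply/esym]; apply: place_far; lia.
- rewrite -(rmorph1 f) -!rmorphM -rmorphN -!linearZ -!rmorphD -linearZ /=; congr (f _).
  apply: phi_inj; apply: val_inj.
  have := ladder_up L3 (isT : (2 < 3)%N); rewrite -l1 -l2 -u1 -u2 => e.
  rewrite !(linearZ, rmorphD, rmorphN, rmorphM, rmorph1) /=.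
  by rewrite linearZ /= rmorphM.
rewrite -!rmorphM -!rmorphB -!rmorphM -rmorphMn -rmorphD -linearZ -rmorphD /=.
congr (f _); apply: phi_inj; apply: val_inj.
have := ladder_down L3 (isT : (2 < 3)%N); rewrite -l1 -l2 -u1 -u2 => e.
rewrite !(rmorphD, rmorphM) /= linearZ /=.
by rewrite !(rmorphD, rmorphN, rmorphM) /=.
Qed.
End Strands.

(** * Matching a matrix algebra with the standard one *)

Lemma int_seq_min (s : seq int) : s != [::] ->
  exists2 m, m \in s & {in s, forall x, (m <= x)%R}.
Proof.
elim: s => // x [|y s] IH _.
  by exists x => [|z]; rewrite ?mem_head // inE => /eqP ->.
have [//|m ms mmin] := IH; have [le_xm|lt_mx] := lerP x m.
  exists x => [|z]; first exact: mem_head.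
  rewrite in_cons => /orP[/eqP -> //|/mmin]; exact: le_trans.
exists m => [|z]; first by rewrite in_cons ms orbT.
by rewrite in_cons => /orP[/eqP ->|/mmin //]; apply: ltW.
Qed.

Lemma lowest_part (k : fieldType) (W : gradedVect k) : (0 < \dim {:W})%N ->
  exists s v, [/\ v != 0, v \in gpart W s
    & forall e, e < s -> gpart W e = 0%VS].
Proof.
rewrite dim_graded => dim_gt0.
have [|s] := @int_seq_min [seq d <- gsupp W | gpart W d != 0%VS].
  apply: contraTneq dim_gt0 => e; rewrite -leqNgt leqn0 big_seq big1 // => d ds.
  apply/eqP; rewrite dimv_eq0; apply/negPn/negP => d0.
  by have : d \in [::] by rewrite -e mem_filter d0.
rewrite mem_filter => /andP[s0 _] smin.
exists s, (vpick (gpart W s)); split=> [||e lt_es]; rewrite ?vpick0 ?memv_pick //.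
apply/eqP/negPn/negP => e0.
have es : e \in gsupp W by apply: contraT => /gsupp_out e0'; rewrite e0' eqxx in e0.
by have := smin e; rewrite mem_filter e0 es leNgt lt_es => /(_ isT).
Qed.

Section Matching.
Variables (k : fieldType) (n : nat) (nu : k) (A : algType k) (W : gradedVect k).
Variables (phi : {linear A -> 'End(W)}) (D Dm : nat -> A).
Hypothesis nu_neq0 : nu != 0.
Hypothesis phi_bij : bijective phi.
Hypothesis phi1 : phi 1 = \1%VF.
Hypothesis phiM : forall a b, phi (a * b) = (phi a \o phi b)%VF.
Hypothesis dimW : \dim {:W} = n`!.
Hypothesis D_ladder : ladder nu n D Dm.
Hypothesis D_deg : forall i, End_homog (-2) (phi (D i)).
Hypothesis Dm_deg : forall i, End_homog 2 (phi (Dm i)).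

Local Notation P := {mpoly k[n]}.
Local Notation low := (lowering n nu n).
Local Notation up := (raising n nu n).
Local Notation harm := (@harm k n nu).

Variables (s : int) (v : W).
Hypothesis v_neq0 : v != 0.
Hypothesis v_part : v \in gpart W s.
Hypothesis s_min : forall e, e < s -> gpart W e = 0%VS.

(** The diagonal action on W (+) k[x]; the submodule generated by (v, 1) will be
the graph of the isomorphism from W onto the polynomials generated by 1. *)
Definition pair_act (x : A * polyEnd k n) (u : W * P) : W * P :=
  (phi x.1 u.1, x.2 u.2).

Definition pair_level : nat -> W * P -> Prop :=
  level (E := (A * polyEnd k n)%type) (V := (W * P)%type)
    (fun i => (Dm i, up i)) pair_act (v, 1).

Lemma pair_act_linear x : linear (pair_act x).
Proof. by move=> c u w; rewrite /pair_act /= linearP EndP. Qed.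

Lemma D_v i : phi (D i) v = 0.
Proof.
apply/eqP; rewrite -memv0 -(@s_min (s - 2)) ?ltrBlDr ?ltrDl //.
by apply: (subvP (D_deg i s)); apply: memv_img.
Qed.

Lemma pair_straighten i j :
  balanced (E := (A * polyEnd k n)%type) (fun i => (D i, low i))
    (fun i => (Dm i, up i)) ((D i, low i) * (Dm j, up j)).
Proof.
exact: (ladder_balanced (ladder_pair D_ladder (poly_ladder nu_neq0 (leqnn n)))).
Qed.

Lemma pair_actM x y u : pair_act (x * y) u = pair_act x (pair_act y u).
Proof. by rewrite /pair_act /= phiM comp_lfunE. Qed.

Lemma pair_act1 u : pair_act 1 u = u.
Proof. by case: u => w p; rewrite /pair_act /= phi1 id_lfunE. Qed.

Lemma pair_act_linearl u : linear (pair_act^~ u).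
Proof.
by move=> c x y; rewrite /pair_act /= linearP add_lfunE scale_lfunE.
Qed.

Lemma low1 i : low i 1 = 0.
Proof. by apply: (low_symm nu_neq0 n 1).2; apply: symm1. Qed.

Lemma pair_act_v i : pair_act (D i, low i) (v, 1) = 0.
Proof. by congr (_, _); [apply: D_v | apply: low1]. Qed.

Lemma pair_lower r i w p : pair_level r.+1 (w, p) ->
  pair_level r (phi (D i) w, low i p).
Proof.
apply: (level_lower pair_act_linear pair_act_linearl pair_actM pair_act1
  pair_act_v pair_straighten i).
Qed.

Lemma pair_lower0 i w p : pair_level 0 (w, p) -> (phi (D i) w, low i p) = 0.
Proof.
apply: (level0_lower pair_act_linear pair_act_linearl pair_actM pair_act1
  pair_act_v pair_straighten i).
Qed.

Lemma pair_raise r i w p : pair_level r (w, p) ->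
  pair_level r.+1 (phi (Dm i) w, up i p).
Proof. exact: level_raise. Qed.

Lemma pair_level_part r w p : pair_level r (w, p) -> w \in gpart W (s + r%:Z *+ 2).
Proof.
rewrite -[w]/((w, p).1); elim: r (w, p) => [|r IH] u.
  by elim=> [|c t t' <- _ IH]; rewrite ?mem0v // memvD ?memvZ //= mul0rn addr0.
elim=> [|c t t' [i [x [/IH xr ->]]] _ IHt]; first exact: mem0v.
apply: memvD => //; apply: memvZ.
have -> : s + r.+1%:Z *+ 2 = s + r%:Z *+ 2 + 2 by rewrite -addn1 PoszD mulrnDl addrA.
by apply: (subvP (Dm_deg i _)); apply: memv_img.
Qed.

Lemma pair_level_harm r w p : pair_level r (w, p) -> harm n r p.
Proof.
rewrite -[p]/((w, p).2); elim: r (w, p) => [|r IH] u.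
  by apply: lspan_map => // t <-; apply: lspan_in.
apply: lspan_map => // t [i [x [/IH xr ->]]]; apply: lspan_in.
by exists i, x.2.
Qed.

Lemma pair_level_lin r c w p w' p' : pair_level r (w, p) ->
  pair_level r (w', p') -> pair_level r (c *: w + w', c *: p + p').
Proof. by move=> wr w'r; apply: (level_lin c wr w'r). Qed.

Lemma harm_pair_level r p : harm n r p -> exists w, pair_level r (w, p).
Proof.
elim: r p => [|r IH] p.
  move=> /harm0P[c ->]; exists (c *: v).
  by apply: (@lspanZ _ (W * P)%type _ c (v, 1)); apply: lspan_in.
elim=> [|c t t' [i [x [/IH[w wx] ->]]] _ [w' w'r]]; first by exists 0; apply: level0.
exists (c *: phi (Dm i) w + w'); apply: pair_level_lin w'r.
exact: pair_raise.
Qed.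

(** The submodule generated by (v, 1) meets 0 (+) k[x] trivially: lowering
operators show by induction that such a polynomial is symmetric, and raised
polynomials that are symmetric vanish. *)
Lemma pair_level_inj r p : pair_level r (0, p) -> p = 0.
Proof.
elim: r p => [|r IH] p pr.
  have [c [/= v0 ->]] : exists c, (0 : W, p).1 = c *: v /\ (0 : W, p).2 = c *: 1.
    elim: pr => [|c t t' <- _ [e [e1 e2]]]; first by exists 0; rewrite !scale0r.
    by exists (c + e); rewrite /= e1 e2 !scalerDl.
  have /eqP := esym v0; rewrite scaler_eq0 (negPf v_neq0) orbF => /eqP ->.
  by rewrite scale0r.
apply: (harm_symm0 nu_neq0 (leqnn n) (pair_level_harm pr)).
apply/(low_symm nu_neq0) => i; apply: IH.
by have := pair_lower i pr; rewrite linear0.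
Qed.

Section Intertwiner.
Variables (I : finType) (h : I -> P) (r : I -> nat) (w : I -> W).
Hypothesis cardI : #|I| = n`!.
Hypothesis h_free : forall c : I -> k, \sum_i c i *: h i = 0 -> forall i, c i = 0.
Hypothesis wh : forall i, pair_level (r i) (w i, h i).

Lemma pair_level_comb R (c : I -> k) : (forall i, r i != R -> c i = 0) ->
  pair_level R (\sum_i c i *: w i, \sum_i c i *: h i).
Proof.
move=> c0; apply: (big_ind2 (fun a b => pair_level R (a, b))).
- exact: level0.
- move=> a b a' b' ab a'b'.
  by have := pair_level_lin 1 ab a'b'; rewrite !scale1r.
move=> i _; have [e|ne] := eqVneq (r i) R.
  rewrite -[c i *: w i]addr0 -[c i *: h i]addr0 -e.
  by apply: pair_level_lin; [apply: wh | apply: level0].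
by rewrite c0 // !scale0r; apply: level0.
Qed.

Lemma gproj_comb d (c : I -> k) : gproj W d (\sum_i c i *: w i) =
  \sum_i (if d == s + (r i)%:Z *+ 2 then c i else 0) *: w i.
Proof.
rewrite linear_sum; apply: eq_bigr => i _; rewrite linearZ /=.
rewrite (gprojE d (pair_level_part (wh i))).
by case: eqP; rewrite ?scaler0 ?scale0r.
Qed.

Lemma shift_inj a b : (s + a%:Z *+ 2 == s + b%:Z *+ 2) = (a == b).
Proof. by rewrite (inj_eq (addrI s)); apply/eqP/eqP; lia. Qed.

(** A relation between the [w i] can be taken homogeneous, and then lifts to a
vector (0, p) of the generated submodule, so the [h i] satisfy it too. *)
Lemma w_free (c : I -> k) : \sum_i c i *: w i = 0 -> forall i, c i = 0.
Proof.
(* Only the terms in the degree of [w j] are kept. *)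
move=> sum0 j; pose c' i := if r j == r i then c i else 0.
have c'w : \sum_i c' i *: w i = 0.
  have := gproj_comb (s + (r j)%:Z *+ 2) c; rewrite sum0 linear0 => /esym e.
  by rewrite -[RHS]e; apply: eq_bigr => i _; rewrite shift_inj.
have := @pair_level_comb (r j) c'; rewrite c'w => lev.
have /h_free /(_ j) : \sum_i c' i *: h i = 0.
  apply: (@pair_level_inj (r j)); apply: lev => i; rewrite /c' eq_sym.
  by move=> /negPf ->.
by rewrite /c' eqxx.
Qed.

Lemma w_part (c : I -> k) e : \sum_i c i *: w i \in gpart W e ->
  forall i, e != s + (r i)%:Z *+ 2 -> c i = 0.
Proof.
move=> ce i ne; pose c' i := if e == s + (r i)%:Z *+ 2 then c i else 0.
have : c i - c' i = 0.
  apply: (w_free (c := fun i => c i - c' i)).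
  transitivity (\sum_i c i *: w i - \sum_i c' i *: w i).
    by rewrite -sumrB; apply: eq_bigr => j _; rewrite scalerBl.
  by rewrite -gproj_comb (gprojE e ce) eqxx subrr.
by rewrite /c' (negPf ne) subr0.
Qed.

Definition w_tuple : #|I|.-tuple W := [tuple w (enum_val i) | i < #|I|].
Definition coef (i : I) : W -> k := coord w_tuple (enum_rank i).

Lemma w_tupleE (i : 'I_#|I|) : w_tuple`_i = w (enum_val i).
Proof. by rewrite -tnth_nth tnth_mktuple. Qed.

Lemma w_tuple_free : free w_tuple.
Proof.
apply/freeP => c sum0 j.
rewrite -[j]enum_valK; move: (enum_val j) => i.
apply: (w_free (c := fun i => c (enum_rank i))).
rewrite (reindex _ (onW_bij _ (@enum_val_bij I))) -[RHS]sum0.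
by apply: eq_bigr => l _; rewrite enum_valK w_tupleE.
Qed.

Lemma coef_sum u : u = \sum_i coef i u *: w i.
Proof.
have b : basis_of fullv w_tuple.
  by rewrite basisEfree w_tuple_free subvf size_tuple cardI dimW leqnn.
rewrite [LHS](coord_basis b (memvf u)).
rewrite [RHS](reindex _ (onW_bij _ (@enum_val_bij I))).
by apply: eq_bigr => l _; rewrite /coef enum_valK w_tupleE.
Qed.

(** The graph of this map is the submodule generated by (v, 1). *)
Definition intertwiner u : P := \sum_i coef i u *: h i.

Lemma intertwiner_linear : linear intertwiner.
Proof.
move=> c u u'; rewrite /intertwiner scaler_sumr -big_split /=; apply: eq_bigr => i _.
by rewrite /coef linearP scalerDl scalerA.
Qed.

HB.instance Definition _ := GRing.isLinear.Build k W P _ intertwiner intertwiner_linear.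

Lemma intertwiner_eq0 u : intertwiner u = 0 -> u = 0.
Proof.
move=> /h_free cf0; rewrite [u]coef_sum big1 // => i _.
by rewrite cf0 scale0r.
Qed.

Lemma intertwiner_inj : injective intertwiner.
Proof.
by move=> u u' e; apply/eqP; rewrite -subr_eq0; apply/eqP/intertwiner_eq0;
  rewrite linearB /= e subrr.
Qed.

Lemma part_pair_level R u : u \in gpart W (s + R%:Z *+ 2) ->
  pair_level R (u, intertwiner u).
Proof.
move=> uR; rewrite {1}[u]coef_sum; apply: pair_level_comb => i ne.
apply: (@w_part (coef^~ u) (s + R%:Z *+ 2)); last by rewrite shift_inj eq_sym.
by rewrite -coef_sum.
Qed.

Lemma intertwiner_pair R u p : pair_level R (u, p) -> intertwiner u = p.
Proof.
move=> up; apply/eqP; rewrite -subr_eq0; apply/eqP.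
apply: (@pair_level_inj R).
have := pair_level_lin (-1) up (part_pair_level (pair_level_part up)).
by rewrite !scaleN1r addNr addrC.
Qed.

Lemma part_even e u : u \in gpart W e -> u != 0 -> exists R : nat, e = s + R%:Z *+ 2.
Proof.
move=> ue; apply: contraPP => none; apply/negP; rewrite negbK; apply/eqP.
apply: intertwiner_eq0; rewrite /intertwiner big1 // => i _.
rewrite (w_part (c := coef^~ u) (e := e)) ?scale0r // -?coef_sum //.
by apply/eqP => e_i; apply: none; exists (r i).
Qed.

Lemma intertwiner_harm R u : u \in gpart W (s + R%:Z *+ 2) -> harm n R (intertwiner u).
Proof. by move=> /part_pair_level /pair_level_harm. Qed.

Lemma intertwiner_v : intertwiner v = 1.
Proof. by apply: (@intertwiner_pair 0); apply: lspan_in. Qed.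

Lemma intertwiner_surj R p : harm n R p -> exists u, intertwiner u = p.
Proof. by move=> /harm_pair_level[u /intertwiner_pair]; exists u. Qed.

Lemma intertwiner_D j u : intertwiner (phi (D j) u) = low j (intertwiner u).
Proof.
have Tw i : intertwiner (phi (D j) (w i)) = low j (h i).
  have := wh i; case: (r i) => [|R]; last by move=> /(pair_lower j)/intertwiner_pair.
  move=> /(pair_lower0 j) e; have /= := congr1 fst e => ->.
  by rewrite linear0; apply: esym (congr1 snd e).
rewrite [in RHS]/intertwiner End_sum {1}[u]coef_sum !linear_sum; apply: eq_bigr => i _.
by rewrite EndZ -Tw !linearZ.
Qed.

Lemma intertwiner_Dm j u : intertwiner (phi (Dm j) u) = up j (intertwiner u).
Proof.
have Tw i : intertwiner (phi (Dm j) (w i)) = up j (h i)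
  by apply/intertwiner_pair/pair_raise/wh.
rewrite [in RHS]/intertwiner End_sum {1}[u]coef_sum !linear_sum; apply: eq_bigr => i _.
by rewrite EndZ -Tw !linearZ.
Qed.

Lemma inNC_low i : inNC (low i).
Proof.
apply: inNC_scale; case: ifP => lt_i; last exact: inNC0.
by rewrite (ddiffE k lt_i); apply: inNC_divdiff.
Qed.

Lemma inNC_up i : inNC (up i).
Proof.
apply: inNC_scale; case: ifP => lt_i; last exact: inNC0.
by rewrite (ddiffmE k lt_i); apply: inNC_divdiff_minus.
Qed.

Definition matched (a : A) : Prop :=
  exists2 b, inNC b & forall u, intertwiner (phi a u) = b (intertwiner u).

Lemma matched_lin c a a' : matched a -> matched a' -> matched (c *: a + a').
Proof.
move=> [b bNC ab] [b' b'NC ab']; exists (c *: b + b'); first exact: inNC_lin.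
by move=> u; rewrite linearP add_lfunE scale_lfunE linearP /= ab ab'.
Qed.

Lemma matchedD a a' : matched a -> matched a' -> matched (a + a').
Proof. by move=> ? ?; rewrite -[a]scale1r; apply: matched_lin. Qed.

Lemma matchedM a a' : matched a -> matched a' -> matched (a * a').
Proof.
move=> [b bNC ab] [b' b'NC ab']; exists (b * b'); first exact: inNC_mul.
by move=> u; rewrite phiM comp_lfunE ab ab'.
Qed.

Lemma matched1 : matched 1.
Proof. by exists 1; [apply: inNC_1 | move=> u; rewrite phi1 id_lfunE]. Qed.

Lemma matched0 : matched 0.
Proof.
by rewrite -(addNr 1) -scaleN1r; apply: matched_lin; apply: matched1.
Qed.

Lemma matched_D i : matched (D i).
Proof. by exists (low i); [apply: inNC_low | apply: intertwiner_D]. Qed.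

Lemma matched_prod (F : nat -> A) l : (forall i, matched (F i)) ->
  matched (\prod_(i <- l) F i).
Proof.
move=> FM; apply: big_ind => [||i _] //; [exact: matched1|exact: matchedM].
Qed.

Lemma harm_inNC R p : harm n R p -> exists2 b, inNC b & b 1 = p.
Proof.
elim: R p => [|R IH] p.
  by move=> /harm0P[c ->]; exists (c *: 1); [apply/inNC_scale/inNC_1|].
elim=> [|c t t' [i [x [/IH[b bNC <-] ->]]] _ [b' b'NC <-]].
  by exists 0; [apply: inNC0|].
exists (c *: (up i * b) + b') => //.
by apply: inNC_lin => //; apply: inNC_mul => //; apply: inNC_up.
Qed.

Lemma intertwiner_inNC u : exists2 b, inNC b & b 1 = intertwiner u.
Proof.
rewrite /intertwiner; apply: (big_ind (fun p => exists2 b, inNC b & b 1 = p)) =>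
  [|p q [b bNC <-] [b' b'NC <-]|i _].
- by exists 0; [apply: inNC0|].
- exists (b + b') => //; rewrite -[b]scale1r; exact: inNC_lin.
have [b bNC <-] := harm_inNC (pair_level_harm (wh i)).
by exists (coef i u *: b) => //; apply: inNC_scale.
Qed.

Let top := (\max_i r i).+1.

Lemma intertwiner_harm_below u : harm_below nu n top (intertwiner u).
Proof.
rewrite /intertwiner; apply: lspan_sum => i _; apply: lspanZ; apply: lspan_in;
  exists (r i).
  by rewrite ltnS leq_bigmax.
exact: pair_level_harm (wh i).
Qed.

Lemma low_word_harm l R p : harm n R p ->
  if (size l <= R)%N then harm n (R - size l) ((\prod_(i <- l) low i) p)
  else (\prod_(i <- l) low i) p = 0.
Proof.
move=> hR; elim: l => [|i l IH]; first by rewrite big_nil subn0.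
rewrite big_cons mulEndE -[size (i :: l)]/(size l).+1.
have [lt_lR|le_Rl] := ltnP (size l) R.
  rewrite (ltnW lt_lR) in IH; apply: (harm_lower nu_neq0) => //.
  by rewrite subnSK.
move: IH; rewrite leq_eqVlt in le_Rl; case/orP: le_Rl => [/eqP ->|lt].
  by rewrite leqnn subnn; apply: harm_lower0.
by rewrite leqNgt lt => ->; rewrite End0.
Qed.

Lemma intertwiner_word l u : intertwiner (phi (\prod_(i <- l) D i) u) =
  (\prod_(i <- l) low i) (intertwiner u).
Proof.
elim: l => [|i l IH]; first by rewrite !big_nil phi1 id_lfunE.
by rewrite !big_cons phiM comp_lfunE mulEndE intertwiner_D IH.
Qed.

Lemma long_word_0 l u : (top <= size l)%N -> phi (\prod_(i <- l) D i) u = 0.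
Proof.
move=> le_top; apply: intertwiner_eq0; rewrite intertwiner_word;
  elim: (intertwiner_harm_below u).
  by rewrite End0.
move=> c p q [R lt_R pR] _ IH; rewrite EndP IH addr0.
have := low_word_harm l pR; rewrite leqNgt (leq_trans _ le_top) //=.
by move=> ->; rewrite scaler0.
Qed.

(** The counterpart in [A] of the symmetrizer: a projection of rank one onto the
lowest degree. *)
Definition ground := \prod_(j <- longest_word n) (D j * Dm j).

Lemma intertwiner_ground u : intertwiner (phi ground u) =
  symmetrizer k n n (intertwiner u).
Proof.
rewrite /ground /symmetrizer.
have : {in longest_word n, forall j, j.+1 < n}%N by move=> j; apply: longest_word_lt.
elim: (longest_word n) => [|j l IH] lt_l; first by rewrite !big_nil phi1 id_lfunE.
rewrite !big_cons !(phiM, comp_lfunE) intertwiner_D intertwiner_Dm IH; last first.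
  by move=> i il; apply: lt_l; rewrite in_cons il orbT.
have lt_j : (j.+1 < n)%N by apply: lt_l; rewrite mem_head.
rewrite /lowering /raising lt_j mulEndE.
by rewrite !scaleEndE EndZ scalerA mulfV ?expf_neq0 // scale1r.
Qed.

Lemma inNC_symmetrizer : inNC (symmetrizer k n n).
Proof.
rewrite /symmetrizer big_seq; apply: big_ind => [||j /longest_word_lt lt_j].
- exact: inNC_1.
- exact: inNC_mul.
rewrite /isobaric (ddiffE k lt_j) (ddiffmE k lt_j).
by apply: inNC_mul; [apply: inNC_divdiff | apply: inNC_divdiff_minus].
Qed.

(** As [ground] maps onto the line of [v], the element [a * ground] only depends
on the polynomial corresponding to [a v], which is obtained from 1 by some
operator. *)
Lemma matched_ground a : matched (a * ground).
Proof.
have [b bNC bv] := intertwiner_inNC (phi a v).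
exists (b * symmetrizer k n n); first exact/inNC_mul/inNC_symmetrizer.
move=> u; have [c Tc] : exists c, intertwiner (phi ground u) = c *: 1.
  apply: (harm_below_symm nu_neq0 (leqnn n) (intertwiner_harm_below (phi ground u))).
  by rewrite intertwiner_ground; apply: symmetrizer_symm.
rewrite phiM comp_lfunE mulEndE -intertwiner_ground Tc EndZ bv.
have -> : phi ground u = c *: v by apply: intertwiner_inj;
  rewrite Tc linearZ /= intertwiner_v.
by rewrite !linearZ.
Qed.

(** Descending induction on the length of the word: [ground] differs from 1 by
a combination of elements ending in a lowering operator, so up to matched
elements the word can be lengthened, and long words vanish. *)
Lemma matched_word m a l : (top <= size l + m)%N -> matched (a * \prod_(i <- l) D i).
Proof.
elim: m a l => [|m IH] a l le_top.
  exists 0; first exact: inNC0.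
  by move=> u; rewrite phiM comp_lfunE long_word_0 ?linear0 // -[size l]addn0.
pose x := \prod_(i <- l) D i.
have step t b : {in t, forall j, j.+1 < n}%N ->
    matched (b * x - b * (\prod_(j <- t) (D j * Dm j)) * x).
  elim: t b => [|j t IHt] b lt_t.
    by rewrite big_nil mulr1 subrr; apply: matched0.
  have lt_j : (j.+1 < n)%N by apply: lt_t; rewrite mem_head.
  set y := \prod_(i <- t) _ in IHt *.
  (* The first factor D_j D_j^- of the product is 1 - D_j^- D_j. *)
  have -> : b * x - b * (\prod_(i <- j :: t) (D i * Dm i)) * x =
      b * Dm j * (D j * x) + (b * (D j * Dm j) * x - b * (D j * Dm j) * y * x).
    rewrite big_cons -/y addrA (mulrA b (D j * Dm j)); congr (_ - _).
    by rewrite (ladder_diag D_ladder lt_j) mulrBr mulr1 mulrBl !mulrA addrC subrK.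
  apply: matchedD; last by apply: IHt => i it; apply: lt_t; rewrite in_cons it orbT.
  by have := IH (b * Dm j) (j :: l); rewrite big_cons /= addSnnS; apply.
have := step (longest_word n) a (fun j => @longest_word_lt n j).
rewrite -/ground -/x => /(matchedD (matchedM (matched_ground a) _)) h'.
have /h' : matched x by apply: matched_prod => i; apply: matched_D.
by rewrite addrC subrK.
Qed.

Theorem all_matched a : matched a.
Proof.
have := @matched_word top a [::]; rewrite big_nil mulr1; apply.
by rewrite leq_addl.
Qed.

Lemma matched_uniq b b' : inNC b -> inNC b' -> (forall u, b (intertwiner u) =
  b' (intertwiner u)) ->
  b = b'.
Proof.
move=> bNC b'NC bb'; apply: (inNC_harm_eq nu_neq0 bNC b'NC) => R p.
by move=> /intertwiner_surj[u <-].
Qed.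

Lemma matching_morphism : exists Phi : {lrmorphism A -> NC k n},
  forall a u, intertwiner (phi a u) = (Phi a : polyEnd k n) (intertwiner u).
Proof.
have /choice[f fP] : forall a, exists b : NC k n,
    forall u, intertwiner (phi a u) = (b : polyEnd k n) (intertwiner u).
  by move=> a; have [b bNC ab] := all_matched a; exists (mkNC bNC).
have uniq (b b' : NC k n) :
    (forall u, (b : polyEnd k n) (intertwiner u) =
      (b' : polyEnd k n) (intertwiner u)) -> b = b'.
  move=> bb'; apply/val_inj/matched_uniq => //; apply/NC_predP/NC_valP.
have [||a b|Phi PhiE] := @lrmorphism_of _ _ _ f.
- move=> c a b; apply: uniq => u.
  by rewrite -fP linearP add_lfunE scale_lfunE linearP /= !fP.
- by apply: uniq => u; rewrite -fP phi1 id_lfunE.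
- by apply: uniq => u; rewrite -fP phiM comp_lfunE !fP.
by exists Phi => a u; rewrite PhiE.
Qed.

Variable Phi : {lrmorphism A -> NC k n}.
Hypothesis PhiP : forall a u, intertwiner (phi a u) =
  (Phi a : polyEnd k n) (intertwiner u).

Lemma Phi_eq a b : inNC b -> (forall u, intertwiner (phi a u) =
  b (intertwiner u)) -> val (Phi a) = b.
Proof.
move=> bNC ab; apply: matched_uniq => //; first exact/NC_predP/NC_valP.
by move=> u; rewrite -PhiP ab.
Qed.

Lemma Phi_D i : val (Phi (D i)) = low i.
Proof. by apply: Phi_eq; [apply: inNC_low | apply: intertwiner_D]. Qed.

Lemma Phi_Dm i : val (Phi (Dm i)) = up i.
Proof. by apply: Phi_eq; [apply: inNC_up | apply: intertwiner_Dm]. Qed.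

Lemma Phi_inj : injective Phi.
Proof.
move=> a a' e; apply: (bij_inj phi_bij); apply/lfunP => u; apply: intertwiner_inj.
by rewrite !PhiP e.
Qed.

Lemma Phi_surj b : exists a, Phi a = b.
Proof.
case: b => b bNC'; have /NC_predP bNC := bNC'.
suff [a ab] : exists a, val (Phi a) = b by exists a; apply: val_inj.
elim: bNC {bNC'} => [i lt_i|i lt_i||c b1 b2 _ [a1 <-] _ [a2 <-]|b1 b2 _ [a1 <-] _ [a2 <-]].
- exists (nu ^- i *: D i); rewrite linearZ /= Phi_D /lowering lt_i (ddiffE k lt_i).
  by rewrite scalerA mulVf ?expf_neq0 // scale1r.
- exists (nu ^+ i *: Dm i); rewrite linearZ /= Phi_Dm /raising lt_i (ddiffmE k lt_i).
  by rewrite scalerA mulfV ?expf_neq0 // scale1r.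
- by exists 1; rewrite rmorph1.
- by exists (c *: a1 + a2); rewrite linearP.
by exists (a1 * a2); rewrite rmorphM.
Qed.

Lemma Phi_bij : bijective Phi.
Proof.
have /choice[g gP] := Phi_surj.
by exists g => // a; apply: Phi_inj.
Qed.

(** Through the intertwiner both conditions speak of the degrees of the values
on the polynomials generated by 1; on all polynomials they follow by linearity
over symmetric polynomials. *)
Lemma Phi_deg d a : End_homog d (phi a) <-> op_degree d (Phi a).
Proof.
split=> [ad|ad e].
  apply: (inNC_harm_degree nu_neq0); first exact/NC_predP/NC_valP.
  move=> R p /harm_pair_level[u up] x.
  rewrite -(intertwiner_pair up) -PhiP => xa.
  have ua : phi a u \in gpart W (s + R%:Z *+ 2 + d).
    by apply: (subvP (ad _)); apply/memv_img/(pair_level_part up).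
  have [e0|nz] := eqVneq (phi a u) 0; first by rewrite e0 linear0 msupp0 in xa.
  have [R' e'] := part_even ua nz; rewrite e' in ua.
  have /dhomogP /(_ x xa) /= := harm_homog nu_neq0 (intertwiner_harm ua); lia.
apply/subvP => _ /memv_imgP[u ue ->].
have [->|nz] := eqVneq u 0; first by rewrite linear0 mem0v.
have [R eE] := part_even ue nz; rewrite eE in ue *.
have TuR := harm_homog nu_neq0 (intertwiner_harm ue); have := PhiP a u.
set u' := phi a u => Tu'.
have [e0|[x xs]] : intertwiner u' = 0 \/ exists x, x \in msupp (intertwiner u').
  case E: (msupp (intertwiner u')) => [|x l]; last by right; exists x; apply: mem_head.
  by left; apply/eqP; rewrite -msupp_eq0 E.
  by rewrite (intertwiner_eq0 e0) mem0v.
have degx := ad R (intertwiner u) TuR x; rewrite -Tu' in degx.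
(* One monomial of the image fixes its degree. *)
have hom : intertwiner u' \is (mdeg x).-homog.
  apply/dhomogP => y ys; have := degx xs; have := ad R (intertwiner u) TuR y.
  by rewrite -Tu' => /(_ ys) /=; lia.
have -> : s + R%:Z *+ 2 + d = s + (mdeg x)%:Z *+ 2 by have := degx xs; lia.
rewrite [u']coef_sum; apply: memv_suml => i _.
have [rx|ne] := eqVneq (r i) (mdeg x).
  by apply: memvZ; rewrite -rx; apply: pair_level_part (wh i).
suff -> : coef i u' = 0 by rewrite scale0r mem0v.
pose c j := if r j == r i then coef j u' else 0.
have /h_free /(_ i) : \sum_j c j *: h j = 0.
  have : pihomog mdeg (r i) (intertwiner u') = 0 by apply: pihomog_ne0 hom;
    rewrite eq_sym.
  apply: etrans; rewrite /intertwiner linear_sum; apply: eq_bigr => j _;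
    rewrite linearZ /= /c.
  have hj := harm_homog nu_neq0 (pair_level_harm (wh j)).
  have [ej|nj] := eqVneq (r j) (r i); first by rewrite -ej pihomog_dE.
  by rewrite (pihomog_ne0 nj hj) scaler0 scale0r.
by rewrite /c eqxx.
Qed.
End Intertwiner.
End Matching.

(** * The isomorphism of tensor systems *)

Lemma matrix_algebra_iso (k : fieldType) n (nu : k) (A : algType k)
    (W : gradedVect k) (phi : {linear A -> 'End(W)}) (D Dm : nat -> A) :
  nu != 0 -> bijective phi -> phi 1 = \1%VF ->
  (forall a b, phi (a * b) = (phi a \o phi b)%VF) -> \dim {:W} = n`! ->
  ladder nu n D Dm -> (forall i, End_homog (-2) (phi (D i))) ->
  (forall i, End_homog 2 (phi (Dm i))) ->
  exists Phi : {lrmorphism A -> NC k n},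
    [/\ bijective Phi,
        forall d a, End_homog d (phi a) <-> op_degree d (Phi a),
        forall i, val (Phi (D i)) = lowering n nu n i
      & forall i, val (Phi (Dm i)) = raising n nu n i].
Proof.
move=> nu0 phi_bij phi1 phiM dimW L Ddeg Dmdeg.
have [|s [v [v0 vs smin]]] := @lowest_part k W; first by rewrite dimW fact_gt0.
have [I [h [r [cardI hr hfree]]]] := harm_family nu0 (leqnn n).
have /choice[w wh] i := harm_pair_level phi Dm v (hr i).
have [Phi PhiP] :=
  matching_morphism nu0 phi1 phiM dimW L Ddeg Dmdeg v0 vs smin cardI hfree wh.
exists Phi; split=> [|d a|i|i].
- exact: (Phi_bij nu0 phi_bij phi1 phiM dimW L Ddeg Dmdeg v0 vs smin cardI hfree wh PhiP).
- exact: (Phi_deg nu0 phi1 phiM dimW L Ddeg Dmdeg v0 vs smin cardI hfree wh PhiP).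
- exact: (Phi_D nu0 phi1 phiM dimW L Ddeg Dmdeg v0 vs smin cardI hfree wh PhiP).
- exact: (Phi_Dm nu0 phi1 phiM dimW L Ddeg Dmdeg v0 vs smin cardI hfree wh PhiP).
Qed.

(** The isomorphism transports generation by divided differences and their
companions from the standard algebra to [A]. *)
Lemma generated_ind (k : fieldType) n (nu : k) (A : algType k)
    (Phi : {lrmorphism A -> NC k n}) (D Dm : nat -> A) (Q : A -> Prop) :
  nu != 0 -> bijective Phi ->
  (forall i, val (Phi (D i)) = lowering n nu n i) ->
  (forall i, val (Phi (Dm i)) = raising n nu n i) ->
  (forall i, (i.+1 < n)%N -> Q (D i)) -> (forall i, (i.+1 < n)%N -> Q (Dm i)) ->
  Q 1 -> (forall c a b, Q a -> Q b -> Q (c *: a + b)) ->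
  (forall a b, Q a -> Q b -> Q (a * b)) -> forall a, Q a.
Proof.
move=> nu0 Phi_bij PhiD PhiDm QD QDm Q1 Qlin QM.
have QZ c a : Q a -> Q (c *: a).
  move=> Qa; rewrite -[_ *: _]addr0; apply: (Qlin c) => //.
  by rewrite -(addNr 1) -scaleN1r; apply: (Qlin _ _ _ Q1 Q1).
have inj := bij_inj Phi_bij; have [g _ gK] := Phi_bij.
have onto b : inNC b -> exists a, val (Phi a) = b.
  by move=> bNC; exists (g (mkNC bNC)); rewrite gK.
suff ind b : inNC b -> forall a, val (Phi a) = b -> Q a.
  by move=> a; apply: (ind (val (Phi a))) => //; apply/NC_predP/NC_valP.
elim=> [i lt_i|i lt_i||c b1 b2 b1NC IH1 b2NC IH2|b1 b2 b1NC IH1 b2NC IH2] a ab.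
- suff -> : a = nu ^- i *: D i by apply/QZ/QD.
  apply/inj/val_inj; rewrite ab linearZ /= PhiD /lowering lt_i (ddiffE k lt_i).
  by rewrite scalerA mulVf ?expf_neq0 // scale1r.
- suff -> : a = nu ^+ i *: Dm i by apply/QZ/QDm.
  apply/inj/val_inj; rewrite ab linearZ /= PhiDm /raising lt_i (ddiffmE k lt_i).
  by rewrite scalerA mulfV ?expf_neq0 // scale1r.
- suff -> : a = 1 by [].
  by apply/inj/val_inj; rewrite ab rmorph1.
- have [a1 e1] := onto b1 b1NC; have [a2 e2] := onto b2 b2NC.
  suff -> : a = c *: a1 + a2 by apply: Qlin; [apply: IH1 | apply: IH2].
  by apply/inj/val_inj; rewrite ab linearP /= -e1 -e2.
have [a1 e1] := onto b1 b1NC; have [a2 e2] := onto b2 b2NC.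
suff -> : a = a1 * a2 by apply: QM; [apply: IH1 | apply: IH2].
by apply/inj/val_inj; rewrite ab rmorphM /= -e1 -e2.
Qed.

Section StandardSystem.
Variables (k : fieldType) (nu : k) (nu_neq0 : nu != 0) (n m : nat).

Lemma NCtensP c (a a' : NC k n) (b : NC k m) :
  NCtens nu_neq0 (c *: a + a') b = c *: NCtens nu_neq0 a b + NCtens nu_neq0 a' b.
Proof. by apply: val_inj; rewrite /= outer_linearl. Qed.

Lemma NCtensPr c (a : NC k n) (b b' : NC k m) :
  NCtens nu_neq0 a (c *: b + b') = c *: NCtens nu_neq0 a b + NCtens nu_neq0 a b'.
Proof. by apply: val_inj; rewrite /= twistP outer_linearr. Qed.

Lemma NCtensM (a a' : NC k n) (b b' : NC k m) :
  NCtens nu_neq0 (a * a') (b * b') = NCtens nu_neq0 a b * NCtens nu_neq0 a' b'.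
Proof. by apply: val_inj; rewrite /= twistM ?nuX_neq0 // outerM. Qed.

Lemma NCtens_1 : NCtens nu_neq0 (1 : NC k n) (1 : NC k m) = 1.
Proof. by apply: val_inj; rewrite /= twist1 ?nuX_neq0 // outer1. Qed.

Lemma outerZl c (a : polyEnd k n) (b : polyEnd k m) :
  outer (c *: a) b = c *: outer a b.
Proof.
have out0 : outer (0 : polyEnd k n) b = 0.
  by have := @outer_linearl k n m b (-1) 0 0; rewrite scaler0 addr0 scaleN1r addNr.
by rewrite -[c *: a]addr0 outer_linearl out0 addr0.
Qed.

Lemma twistZ c d (b : polyEnd k m) : twist c (d *: b) = d *: twist c b.
Proof. by rewrite /twist -scalerAr -scalerAl. Qed.

Section Generators.
Variable i : nat.

Lemma NCtens_lowl (a : NC k n) : (i.+1 < n)%N -> val a = lowering n nu n i ->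
  val (NCtens nu_neq0 a (1 : NC k m)) = lowering (n + m) nu (n + m) i.
Proof.
move=> lt_i aE; rewrite /= [NC_val a]aE twist1 ?nuX_neq0 //.
have lt_im : (i.+1 < n + m)%N by rewrite ltn_addr.
rewrite /lowering lt_i lt_im (ddiffE k lt_i) (ddiffE k lt_im) outerZl.
by rewrite (outer_divdiffl k lt_i lt_im).
Qed.

Lemma NCtens_upl (a : NC k n) : (i.+1 < n)%N -> val a = raising n nu n i ->
  val (NCtens nu_neq0 a (1 : NC k m)) = raising (n + m) nu (n + m) i.
Proof.
move=> lt_i aE; rewrite /= [NC_val a]aE twist1 ?nuX_neq0 //.
have lt_im : (i.+1 < n + m)%N by rewrite ltn_addr.
rewrite /raising lt_i lt_im (ddiffmE k lt_i) (ddiffmE k lt_im) outerZl.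
by rewrite (outer_divdiff_minusl k lt_i lt_im).
Qed.

Lemma NCtens_lowr (b : NC k m) : (i.+1 < m)%N -> val b = lowering m nu m i ->
  val (NCtens nu_neq0 (1 : NC k n) b) = lowering (n + m) nu (n + m) (n + i).
Proof.
move=> lt_i bE; rewrite /= [NC_val b]bE.
have lt_ni : ((n + i).+1 < n + m)%N by lia.
rewrite /lowering lt_i lt_ni (ddiffE k lt_i) (ddiffE k lt_ni) twistZ.
rewrite twist_divdiff ?nuX_neq0 // invrK !outerZr scalerA -exprD (addnC i n).
by rewrite (outer_divdiffr k lt_i lt_ni).
Qed.

Lemma NCtens_upr (b : NC k m) : (i.+1 < m)%N -> val b = raising m nu m i ->
  val (NCtens nu_neq0 (1 : NC k n) b) = raising (n + m) nu (n + m) (n + i).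
Proof.
move=> lt_i bE; rewrite /= [NC_val b]bE.
have lt_ni : ((n + i).+1 < n + m)%N by lia.
rewrite /raising lt_i lt_ni (ddiffmE k lt_i) (ddiffmE k lt_ni) twistZ.
rewrite twist_divdiff_minus ?nuX_neq0 // !outerZr scalerA -invfM -exprD (addnC i n).
by rewrite (outer_divdiff_minusr k lt_i lt_ni).
Qed.
End Generators.
End StandardSystem.

Theorem theorem3p7 (k : fieldType) (C : tensorSystem k)
    (C_min : graded_minimal_categorification C)
    (nu : k) (nu_neq0 : nu != 0) (C_std : nu_standard C nu) :
  tensorSystem_iso C (NCsystem nu_neq0).
Proof.
have [d [dm [[d_deg dm_deg] _ _ d_dm [phi3 [[phi3_bij _] pd1 pd2 pm1 pm2]]]]] := C_std.
have L n : ladder nu n (cross d n) (cross_dual dm n).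
  exact: (cross_ladder C_min nu_neq0 d_dm (bij_inj phi3_bij) pd1 pd2 pm1 pm2).
have place2_deg e (x : alg C 2) n i : has_deg C e x ->
  has_deg C e (place n i x) \/ place n i x = 0.
  move=> xe; have [out|le] := ltnP n (i + 2); first by right; apply: place_out.
  by left; apply: place_deg.
have Phi_ex n : exists Phi : {lrmorphism alg C n -> NC k n},
    [/\ bijective Phi,
        forall e (a : alg C n), has_deg C e a <-> op_degree e (Phi a),
        forall i, val (Phi (cross d n i)) = lowering n nu n i
      & forall i, val (Phi (cross_dual dm n i)) = raising n nu n i].
  have [/(_ n)[W gW [phi [phi_bij phi1 phiM deg]]] _ _ _ _] := C_min.
  have homog0 e : End_homog e (phi 0).
    by rewrite linear0 => e'; rewrite lim0g sub0v.
  have [i|i|Phi [bij PhiE PhiD PhiDm]] :=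
    matrix_algebra_iso nu_neq0 phi_bij phi1 phiM (dim_qfact gW) (L n).
  - rewrite /cross; have [dd|->] := place2_deg _ _ n i d_deg; last exact: homog0.
    exact/deg.
  - rewrite /cross_dual; have [dd|->] := place2_deg _ _ n i dm_deg; last exact: homog0.
    exact/deg.
  exists Phi; split=> // e a; split=> [/deg/PhiE //|/PhiE/deg //].
pose Phi n := sval (cid (Phi_ex n)).
have PhiP n : [/\ bijective (Phi n),
    forall e (a : alg C n), has_deg C e a <-> op_degree e (Phi n a),
    forall i, val (Phi n (cross d n i)) = lowering n nu n i
  & forall i, val (Phi n (cross_dual dm n i)) = raising n nu n i].
  exact: svalP (cid (Phi_ex n)).
exists Phi; split=> [n|n e a|n m a b].
- by have [] := PhiP n.
- by have [_ deg _ _] := PhiP n; apply: deg.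
have [bij_n _ D_n Dm_n] := PhiP n; have [bij_m _ D_m Dm_m] := PhiP m.
have [_ _ D_nm Dm_nm] := PhiP (n + m)%N.
have left (x : alg C n) : Phi (n + m)%N (tens C x (1 : alg C m)) =
    NCtens nu_neq0 (Phi n x) (1 : NC k m).
  apply: (generated_ind (Phi := Phi n) (D := cross d n) (Dm := cross_dual dm n)
    (Q := fun x => Phi (n + m)%N (tens C x 1) = NCtens nu_neq0 (Phi n x) 1)
    nu_neq0 bij_n D_n Dm_n).
  - move=> i lt_i; apply: val_inj; rewrite (NCtens_lowl _ _ lt_i) // tensl_place //.
      exact: D_nm.
    by lia.
  - move=> i lt_i; apply: val_inj; rewrite (NCtens_upl _ _ lt_i) // tensl_place //.
      exact: Dm_nm.
    by lia.
  - by rewrite tens1 // !rmorph1 NCtens_1.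
  - move=> c y z Qy Qz.
    by rewrite (tens_linearl C_min) !linearP /= Qy Qz NCtensP.
  move=> y z Qy Qz; rewrite -[1 : alg C m]mulr1 tensM // !rmorphM /= Qy Qz.
  by rewrite -NCtensM mulr1.
have right (y : alg C m) : Phi (n + m)%N (tens C (1 : alg C n) y) =
    NCtens nu_neq0 (1 : NC k n) (Phi m y).
  apply: (generated_ind (Phi := Phi m) (D := cross d m) (Dm := cross_dual dm m)
    (Q := fun y => Phi (n + m)%N (tens C 1 y) = NCtens nu_neq0 1 (Phi m y))
    nu_neq0 bij_m D_m Dm_m).
  - move=> i lt_i; apply: val_inj; rewrite (NCtens_lowr _ _ lt_i) // tensr_place //.
      exact: D_nm.
    by lia.
  - move=> i lt_i; apply: val_inj; rewrite (NCtens_upr _ _ lt_i) // tensr_place //.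
      exact: Dm_nm.
    by lia.
  - by rewrite tens1 // !rmorph1 NCtens_1.
  - move=> c x z Qx Qz.
    by rewrite (tens_linearr C_min) !linearP /= Qx Qz NCtensPr.
  move=> x z Qx Qz; rewrite -[1 : alg C n]mulr1 tensM // !rmorphM /= Qx Qz.
  by rewrite -NCtensM mulr1.
have -> : tens C a b = tens C a 1 * tens C 1 b by rewrite -tensM // mulr1 mul1r.
rewrite rmorphM /= left right -NCtensM.
by rewrite mulr1 mul1r.
Qed.
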